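(* There exist constants $c,C>0$ such that for all $n\in\mathbb{N}$ and every strictly convex, twice differentiable Orlicz function $M:[0,\infty)\to[0,\infty)$ that is strictly $2$-concave and satisfies $M^*(1)=1$, the space $\ell_M^n$ $C$-embeds into $\ell_1^{cn^3}$.
   Context: An Orlicz function is a convex function $M:[0,\infty)\to[0,\infty)$ with $M(0)=0$ that is not constant. Its conjugate function is $M^*(x)=\sup_{t\in[0,\infty)}(xt-M(t))$. $M$ is strictly $2$-concave if $t\mapsto M(\sqrt t)$ is strictly concave on $[0,\infty)$. $\ell_M^n$ is $\mathbb{R}^n$ with the Luxemburg norm $\|x\|_M=\inf\{\lambda>0:\sum_{i=1}^nM(|x_i|/\lambda)\le1\}$, and $\ell_1^m$ is $\mathbb{R}^m$ with the norm $\sum|x_i|$; the dimension $cn^3$ is understood to be an integer (rounded up if necessary). For normed spaces $X,Y$ and a constant $C\ge1$, $X$ $C$-embeds into $Y$ if there exists a one-to-one linear operator $\Psi:X\to\Psi(X)\subseteq Y$ with $\|\Psi\|\cdot\|\Psi^{-1}\|\le C$. The constants $c,C$ do not depend on $n$ or $M$. *)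

(* Defs.v *)
From HB Require Import structures.
From mathcomp Require Import all_boot all_order all_algebra.
From mathcomp Require Import all_classical all_reals all_analysis.
Set Implicit Arguments.
Unset Strict Implicit.
Unset Printing Implicit Defensive.
Import Order.TTheory GRing.Theory Num.Theory.
Import numFieldNormedType.Exports.
Local Open Scope classical_set_scope.
Local Open Scope ring_scope.

(* A function [0, +oo[ -> [0, +oo[ is represented by a map R -> R; no definition
   below depends on its values at negative arguments. *)

Definition strictly_convex_on (R : realType) (D : set R) (f : R -> R) : Prop :=
  forall x y t : R, D x -> D y -> x != y -> 0 < t < 1 ->
    f (t * x + (1 - t) * y) < t * f x + (1 - t) * f y.

Definition strictly_concave_on (R : realType) (D : set R) (f : R -> R) : Prop :=
  forall x y t : R, D x -> D y -> x != y -> 0 < t < 1 ->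
    t * f x + (1 - t) * f y < f (t * x + (1 - t) * y).

(* The points at which the difference quotient is evaluated range over D, so
   that on [0, +oo[ the derivative at 0 is the right derivative. *)
Definition is_deriv_on (R : realType) (D : set R) (f f' : R -> R) : Prop :=
  forall x : R, D x ->
    (f y - f x) / (y - x) @[y --> within D x^'] --> f' x.

Definition twice_differentiable_on (R : realType) (D : set R) (f : R -> R) :
    Prop :=
  exists f' f'' : R -> R, is_deriv_on D f f' /\ is_deriv_on D f' f''.

Definition Orlicz_function (R : realType) (M : R -> R) : Prop :=
  [/\ forall x : R, 0 <= x -> 0 <= M x,
      convex_function (`[0, +oo[%classic : set R^o) (M : R^o -> R^o),
      M 0 = 0
    & exists x y : R, [/\ 0 <= x, 0 <= y & M x != M y]].

Definition conjugate (R : realType) (M : R -> R) (x : R) : \bar R :=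
  ereal_sup [set (x * t - M t)%:E | t in `[0, +oo[%classic].

Definition strictly_2concave (R : realType) (M : R -> R) : Prop :=
  strictly_concave_on `[0, +oo[%classic (fun t : R => M (Num.sqrt t)).

Definition Luxemburg_norm (R : realType) (M : R -> R) (n : nat)
    (x : 'rV[R]_n) : R :=
  inf [set l : R | 0 < l /\ \sum_(i < n) M (`|x ord0 i| / l) <= 1].

Definition l1_norm (R : realType) (m : nat) (x : 'rV[R]_m) : R :=
  \sum_(i < m) `|x ord0 i|.

(* Operator norm of T : D -> Y for a subspace D of X. *)
Definition op_norm (R : realType) (X Y : lmodType R) (NX : X -> R)
    (NY : Y -> R) (D : set X) (T : X -> Y) : \bar R :=
  ereal_sup [set (NY (T x))%:E | x in D `&` [set x | NX x <= 1]].

(* Phi is the inverse of Psi : X -> Psi(X); its values outside Psi(X) do not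
   matter. *)
Definition C_embeds (R : realType) (C : R) (X Y : lmodType R)
    (NX : X -> R) (NY : Y -> R) : Prop :=
  1 <= C /\
  exists (Psi : {linear X -> Y}) (Phi : Y -> X),
    [/\ injective Psi, cancel Psi Phi
      & (op_norm NX NY setT Psi * op_norm NY NX (range Psi) Phi <= C%:E)%E].

(* Main.v *)
Require Import Defs.
From HB Require Import structures.
From mathcomp Require Import all_boot all_order all_algebra.
From mathcomp Require Import all_classical all_reals all_analysis.
From mathcomp Require Import ring lra zify.
Import Order.TTheory GRing.Theory Num.Theory.
Import numFieldNormedType.Exports.
Local Open Scope classical_set_scope.
Local Open Scope ring_scope.

(* Let f_1, ..., f_n be independent copies of a random variable f >= 0 and let
   eps_1, ..., eps_n be independent signs.  The norm T x = E |sum x_i eps_i f_i|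
   is equivalent to the Luxemburg norm of t |-> E phi (t f), where
   phi u = min (u^2, u): the upper estimate splits the sum at |x_i f_i| = 1, the
   lower one combines Khintchine's inequality with a second moment argument.
   Convexity and 2-concavity of M say exactly that M t / t increases and
   M t / t^2 decreases, hence M t / t is, on the grid j / n and up to a factor 2,
   a concave function, i.e. a positive combination of the functions
   t |-> min (t, s); this yields an f with values n / l, l <= n, such that
   E phi (t f) is equivalent to M t on the grid.  Finally c n^3 independent
   samples of the vector (eps_i f_i) reproduce T on a grid of the cube up to a
   constant, by a Chernoff bound, and then on the whole space; the grid has
   exp (O (n sqrt n)) points and the summands are bounded by O (n sqrt n) times
   their mean. *)

(** * Weighted means on finite sets and product weights *)

Definition mean {R : realType} {T : finType} (w g : T -> R) : R :=
  \sum_t w t * g t.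

Definition pweight {R : realType} {T : finType} (w : T -> R) : Prop :=
  (forall t, 0 <= w t) /\ \sum_t w t = 1.

Definition prodw {R : realType} (I : finType) {V : finType} (w : V -> R)
  (o : {ffun I -> V}) : R := \prod_i w (o i).

Lemma eq_mean (R : realType) (T : finType) (w g h : T -> R) :
  (forall t, g t = h t) -> mean w g = mean w h.
Proof. by move=> gh; apply: eq_bigr => t _; rewrite gh. Qed.

Lemma mean_cst (R : realType) (T : finType) (w : T -> R) (a : R) :
  pweight w -> mean w (fun=> a) = a.
Proof. by case=> _ w1; rewrite /mean -mulr_suml w1 mul1r. Qed.

Lemma meanD (R : realType) (T : finType) (w g h : T -> R) :
  mean w (fun t => g t + h t) = mean w g + mean w h.
Proof. by rewrite /mean -big_split; apply: eq_bigr => t _; rewrite mulrDr. Qed.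

Lemma meanZ (R : realType) (T : finType) (w g : T -> R) (a : R) :
  mean w (fun t => a * g t) = a * mean w g.
Proof. by rewrite /mean mulr_sumr; apply: eq_bigr => t _; rewrite mulrCA. Qed.

Lemma meanB (R : realType) (T : finType) (w g h : T -> R) :
  mean w (fun t => g t - h t) = mean w g - mean w h.
Proof.
rewrite /mean -sumrB; apply: eq_bigr => t _; by rewrite mulrBr.
Qed.

Lemma mean_sum (R : realType) (T I : finType) (w : T -> R) (g : I -> T -> R) :
  mean w (fun t => \sum_i g i t) = \sum_i mean w (g i).
Proof.
by rewrite /mean exchange_big; apply: eq_bigr => t _; rewrite mulr_sumr.
Qed.

Lemma ler_mean (R : realType) (T : finType) (w g h : T -> R) :
  pweight w -> (forall t, g t <= h t) -> mean w g <= mean w h.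
Proof. by case=> w0 _ gh; apply: ler_sum => t _; apply: ler_wpM2l. Qed.

Lemma mean_ge0 (R : realType) (T : finType) (w g : T -> R) :
  pweight w -> (forall t, 0 <= g t) -> 0 <= mean w g.
Proof. by case=> w0 _ g0; apply: sumr_ge0 => t _; rewrite mulr_ge0. Qed.

(** Distributivity of the product over the sums. Taking all but one or two factors constantly 1
    yields the marginals and the independence of distinct coordinates. *)
Lemma mean_prod (R : realType) (I V : finType) (w : V -> R) (g : I -> V -> R) :
  mean (prodw I w) (fun o => \prod_i g i (o i)) = \prod_i mean w (g i).
Proof.
rewrite /mean bigA_distr_bigA /=.
by apply: eq_bigr => o _; rewrite /prodw -big_split.
Qed.

Lemma prodw_pweight (R : realType) (I V : finType) (w : V -> R) :
  pweight w -> pweight (prodw I w).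
Proof.
move=> [w0 w1]; split; first by move=> o; apply: prodr_ge0.
have := mean_prod R I V w (fun _ _ => 1).
rewrite /mean => h.
transitivity (\sum_o prodw I w o * \prod_(i : I) (1 : R)).
  by apply: eq_bigr => o _; rewrite big1 ?mulr1.
rewrite h big1 // => i _.
by under eq_bigr do rewrite mulr1.
Qed.

Lemma mean_coord (R : realType) (I V : finType) (w : V -> R) (g : V -> R)
    (i : I) :
  pweight w -> mean (prodw I w) (fun o => g (o i)) = mean w g.
Proof.
move=> pw; have := mean_prod R I V w (fun k v => if k == i then g v else 1).
rewrite [RHS](bigD1 i) //= big1 ?mulr1.
  rewrite eqxx => <-; apply: eq_mean => o.
  rewrite (bigD1 i) //= eqxx big1 ?mulr1 // => k /negbTE ->//.
by move=> k /negbTE ->; apply: mean_cst.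
Qed.

Lemma mean_coord2 (R : realType) (I V : finType) (w : V -> R) (g h : V -> R)
    (i j : I) :
  pweight w -> i != j ->
  mean (prodw I w) (fun o => g (o i) * h (o j)) = mean w g * mean w h.
Proof.
move=> pw ij; have ji : j != i by rewrite eq_sym.
have := mean_prod R I V w
  (fun k v => if k == i then g v else if k == j then h v else 1).
rewrite [RHS](bigD1 i) //= (bigD1 j) //= big1 ?mulr1.
  rewrite !eqxx (negbTE ji) => <-; apply: eq_mean => o.
  rewrite (bigD1 i) //= eqxx (bigD1 j) //= eqxx (negbTE ji) big1 ?mulr1 //.
  by move=> k /andP[/negbTE -> /negbTE ->].
by move=> k /andP[/negbTE -> /negbTE ->]; apply: mean_cst.
Qed.

Lemma pweight_pair (R : realType) (S T : finType) (w : S -> R) (w' : T -> R) :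
  pweight w -> pweight w' -> pweight (fun t : S * T => w t.1 * w' t.2).
Proof.
move=> [w0 w1] [w0' w1']; split; first by move=> t; rewrite mulr_ge0.
rewrite -(pair_bigA _ (fun s t => w s * w' t)) /= -w1.
by apply: eq_bigr => s _; rewrite -mulr_sumr w1' mulr1.
Qed.

Lemma mean_pair (R : realType) (S T : finType) (w : S -> R) (w' : T -> R)
    (g : S * T -> R) :
  mean (fun t : S * T => w t.1 * w' t.2) g =
  mean w (fun s => mean w' (fun t => g (s, t))).
Proof.
transitivity (\sum_s \sum_t w s * w' t * g (s, t)).
  by rewrite pair_bigA /=; apply: eq_bigr => -[].
by apply: eq_bigr => s _; rewrite mulr_sumr; apply: eq_bigr => t _; rewrite mulrA.
Qed.

(** * Rademacher sums and Khintchine's inequality *)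

Definition signw {R : realType} (I : finType) : {ffun I -> bool} -> R :=
  prodw I (fun=> 2^-1).

Lemma signw_pweight (R : realType) (I : finType) : pweight (@signw R I).
Proof.
apply: prodw_pweight; split => [_|]; first by rewrite invr_ge0 ler0n.
by rewrite big_bool /=; lra.
Qed.

Definition rsum {R : realType} {I : finType} (s : {ffun I -> bool}) (y : I -> R) : R :=
  \sum_i (-1) ^+ s i * y i.

Definition flip {I : finType} (i : I) (s : {ffun I -> bool}) : {ffun I -> bool} :=
  [ffun k => if k == i then ~~ s k else s k].

Lemma flipK (I : finType) (i : I) : involutive (flip i).
Proof.
by move=> s; apply/ffunP => k; rewrite !ffunE; case: (k == i); rewrite ?negbK.
Qed.

(** Flipping the sign at [i] is an involution that preserves the weight and negates the integrand,
    so the mean equals its own opposite. *)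
Lemma mean_sign0 (R : realType) (I : finType) (i : I) (g : {ffun I -> bool} -> R) :
  (forall s, g (flip i s) = g s) ->
  mean (@signw R I) (fun s => g s * (-1) ^+ s i) = 0.
Proof.
move=> gi.
have : mean (@signw R I) (fun s => g s * (-1) ^+ s i) =
   - mean (@signw R I) (fun s => g s * (-1) ^+ s i).
  rewrite {1}/mean (reindex_inj (inv_inj (flipK _ i))) /= /mean -sumrN.
  apply: eq_bigr => s _; rewrite gi [flip i s i]ffunE eqxx /signw /prodw.
  by case: (s i) => /=; ring.
lra.
Qed.

(** Induction on the index list: the sum over [r] does not involve the sign at the new index [i], so
    by [mean_sign0] the odd cross terms vanish. With B the second moment over [r], the fourth moment
    becomes at most 3 B^2 + 6 y_i^2 B + y_i^4, which is below 3 (B + y_i^2)^2. *)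
Lemma rademacher_moments (R : realType) (I : finType) (y : I -> R) (r : seq I) :
  uniq r ->
  mean (@signw R I) (fun s => (\sum_(i <- r) (-1) ^+ s i * y i) ^+ 2) =
    \sum_(i <- r) y i ^+ 2 /\
  mean (@signw R I) (fun s => (\sum_(i <- r) (-1) ^+ s i * y i) ^+ 4) <=
    3 * (\sum_(i <- r) y i ^+ 2) ^+ 2.
Proof.
elim: r => [_|i r IH /= /andP[ir /IH [IH2 IH4]]].
  have pS := signw_pweight R I; rewrite big_nil expr0n mulr0; split.
    rewrite -[RHS](mean_cst _ _ _ 0 pS); apply: eq_mean => s.
    by rewrite big_nil expr0n.
  rewrite -[leRHS](mean_cst _ _ _ 0 pS); apply: ler_mean => // s.
  by rewrite big_nil expr0n.
set S := fun s : {ffun I -> bool} => \sum_(k <- r) (-1) ^+ s k * y k.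
have Sf s : S (flip i s) = S s.
  apply: eq_big_seq => k kr; rewrite ffunE.
  by case: eqP => // ki; rewrite -ki kr in ir.
have m1 : mean (@signw R I) (fun s => S s * (-1) ^+ s i) = 0.
  by apply: mean_sign0 => s; rewrite Sf.
have m3 : mean (@signw R I) (fun s => S s ^+ 3 * (-1) ^+ s i) = 0.
  by apply: (@mean_sign0 _ _ _ (fun s => S s ^+ 3)) => s; rewrite Sf.
have pS := signw_pweight R I.
have sE (s : {ffun I -> bool}) : ((-1) ^+ s i) ^+ 2 = 1 :> R by rewrite sqrr_sign.
rewrite big_cons; split.
  rewrite -IH2.
  transitivity (mean (@signw R I) (fun s => S s ^+ 2 + (2 * y i) * (S s * (-1) ^+ s
      i) + y i ^+ 2)).
    apply: eq_mean => s; rewrite big_cons -/(S s) .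
    have := sE s; set e := (-1) ^+ _ => he.
    by rewrite sqrrD exprMn he; ring.
  by rewrite !meanD meanZ m1 (mean_cst _ _ _ _ pS); rewrite /S; ring.
rewrite -/S in IH4; rewrite -IH2 in IH4 *.
apply: (@le_trans _ _ (mean (@signw R I) (fun s => S s ^+ 4 + (4 * y i) * (S s ^+ 3
    * (-1) ^+ s i)
   + (6 * y i ^+ 2) * S s ^+ 2 + (4 * y i ^+ 3) * (S s * (-1) ^+ s i) + y i ^+ 4))).
  apply: ler_mean; first exact: signw_pweight.
  move=> s; rewrite big_cons -/(S s) .
  have := sE s; set e := (-1) ^+ _ => he.
  suff -> : (e * y i + S s) ^+ 4 = S s ^+ 4 + (4 * y i) * (S s ^+ 3 * e)
   + (6 * y i ^+ 2) * S s ^+ 2 * e ^+ 2 + (4 * y i ^+ 3) * (S s * e) * e ^+ 2 + y i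
       ^+ 4 * (e ^+ 2) ^+ 2.
    by rewrite he expr1n !mulr1.
  by ring.
rewrite !meanD !meanZ m1 m3 (mean_cst _ _ _ _ pS).
have : 0 <= y i ^+ 4 by rewrite exprn_even_ge0.
move: IH4; rewrite -/S; set A := mean _ _; set B := mean _ (fun s => S s ^+ 2).
by move=> h1 h2; nra.
Qed.

Lemma rademacher_sq (R : realType) (I : finType) (y : I -> R) :
  mean (@signw R I) (fun s => rsum s y ^+ 2) = \sum_i y i ^+ 2.
Proof. by have [] := @rademacher_moments R I y _ (index_enum_uniq I). Qed.

Lemma rademacher_fourth (R : realType) (I : finType) (y : I -> R) :
  mean (@signw R I) (fun s => rsum s y ^+ 4) <= 3 * (\sum_i y i ^+ 2) ^+ 2.
Proof. by have [] := @rademacher_moments R I y _ (index_enum_uniq I). Qed.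

Definition rademacher_norm {R : realType} {I : finType} (y : I -> R) : R :=
  mean (@signw R I) (fun s => `|rsum s y|).

Definition phi {R : realType} (u : R) : R := Num.min (u ^+ 2) u.

(** With r the Euclidean norm of y, every u >= 0 satisfies u >= u^2 / r - u^4 / (6 r^3), because v^3
    - 6 v + 6 >= 0 for v = u / r >= 0. Averaging at u = |sum| and using the second and fourth
    moments leaves r - r / 2. *)
Lemma khintchine (R : realType) (I : finType) (y : I -> R) :
  Num.sqrt (\sum_i y i ^+ 2) / 2 <= rademacher_norm y.
Proof.
set q := \sum_i _; have q0 : 0 <= q by apply: sumr_ge0 => i _; rewrite sqr_ge0.
set r := Num.sqrt q; have r0 : 0 <= r by rewrite sqrtr_ge0.
have r2 : r ^+ 2 = q by rewrite sqr_sqrtr.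
have [->|rN0] := eqVneq r 0.
  by rewrite mul0r; apply: mean_ge0 => //; apply: signw_pweight.
have rp : 0 < r by rewrite lt_def rN0.
have pt s : rsum s y ^+ 2 / r - rsum s y ^+ 4 / (6 * r ^+ 3) <= `|rsum s y|.
  set u := `|rsum s y|; have u0 : 0 <= u by rewrite normr_ge0.
  have -> : rsum s y ^+ 2 = u ^+ 2 by rewrite real_normK ?num_real.
  have -> : rsum s y ^+ 4 = u ^+ 4.
    by rewrite (exprM _ 2 2) (exprM _ 2 2) real_normK ?num_real.
  rewrite -subr_ge0.
  have -> : u - (u ^+ 2 / r - u ^+ 4 / (6 * r ^+ 3)) =
      u * (6 - 6 * (u / r) + (u / r) ^+ 3) / 6 by field.
  have : 0 <= u / r by rewrite divr_ge0.
  set v := u / r => v0; rewrite divr_ge0 ?mulr_ge0 //.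
  have := sqr_ge0 (v - 3 / 2); have := sqr_ge0 v.
  nra.
have := ler_mean _ _ _ _ _ (signw_pweight R I) pt.
rewrite meanB.
under eq_mean do rewrite mulrC.
rewrite meanZ rademacher_sq -/q -r2.
under [X in _ - X]eq_mean do rewrite mulrC.
rewrite meanZ -/(rademacher_norm y); apply: le_trans.
have := rademacher_fourth R I y; rewrite -/q -r2 => h4.
have -> : r^-1 * r ^+ 2 = r by field.
have : (6 * r ^+ 3)^-1 * mean (signw I) (fun t => rsum t y ^+ 4) <= (6 * r ^+ 3)^-1
    * (3 * (r ^+ 2) ^+ 2).
  by rewrite ler_wpM2l // invr_ge0 mulr_ge0 // exprn_ge0.
have -> : (6 * r ^+ 3)^-1 * (3 * (r ^+ 2) ^+ 2) = r / 2 by field.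
lra.
Qed.

Lemma phi_le1 (R : realType) (u : R) : 0 <= u <= 1 -> phi u = u ^+ 2.
Proof. by move=> /andP[u0 u1]; rewrite /phi min_l // expr2 ler_piMr. Qed.

Lemma phi_ge1 (R : realType) (u : R) : 1 <= u -> phi u = u.
Proof. by move=> u1; rewrite /phi min_r // expr2 ler_peMr // (le_trans _ u1). Qed.

Lemma phi_mono (R : realType) (u v : R) : 0 <= u <= v -> phi u <= phi v.
Proof.
move=> /andP[u0 uv]; rewrite /phi le_min !ge_min uv orbT andbT.
by rewrite lerXn2r // nnegrE // (le_trans u0).
Qed.

(** The entries of modulus at most 1 form a sum whose modulus is at most 1/2 plus half its square,
    and the mean square is explicit; the larger entries are bounded by the triangle inequality. *)
Lemma rademacher_norm_le_phi (R : realType) (I : finType) (y : I -> R) :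
  rademacher_norm y <= 2^-1 + \sum_i phi `|y i|.
Proof.
pose a i := if `|y i| <= 1 then y i else 0.
pose b i := if `|y i| <= 1 then 0 else `|y i|.
have pt s : `|rsum s y| <= 2^-1 + (rsum s a ^+ 2 / 2 + \sum_i b i).
  have -> : rsum s y = rsum s a + \sum_i (-1) ^+ s i * (y i - a i).
    by rewrite /rsum -big_split; apply: eq_bigr => i _ /=; ring.
  rewrite addrA; apply: le_trans (ler_normD _ _) _; apply: lerD.
    rewrite -[X in X / 2]real_normK ?num_real //.
    have := sqr_ge0 (`|rsum s a| - 1); nra.
  apply: le_trans (ler_norm_sum _ _ _) _; apply: ler_sum => i _.
  rewrite normrM normrX normrN1 expr1n mul1r /a /b.
  by case: ifP; rewrite ?subrr ?normr0 ?subr0.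
have := ler_mean _ _ _ _ _ (signw_pweight R I) pt.
rewrite !meanD !mean_cst; try exact: signw_pweight.
under [X in _ + (X + _)]eq_mean do rewrite mulrC.
rewrite meanZ rademacher_sq; move/le_trans; apply.
rewrite lerD2l mulr_sumr -big_split; apply: ler_sum => i _ /=.
rewrite /a /b; case: ifPn => [h|]; last rewrite -ltNge => /ltW h.
  rewrite phi_le1 ?normr_ge0 // real_normK ?num_real //.
  have := sqr_ge0 (y i); lra.
by rewrite phi_ge1 // expr0n /= mulr0 add0r.
Qed.

(** * Lower bounds for the mean Euclidean norm of independent coordinates *)

Definition clip {R : realType} (u : R) : R := Num.min u 1 ^+ 2.

Lemma clip_itv (R : realType) (u : R) : 0 <= u -> 0 <= clip u <= 1.
Proof.
move=> u0; rewrite /clip sqr_ge0 /= expr_le1 ?ge_min ?lexx ?orbT //.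
by rewrite le_min u0 ler01.
Qed.

Lemma clip_le_sqr (R : realType) (u : R) : 0 <= u -> clip u <= u ^+ 2.
Proof.
by move=> u0; rewrite /clip lerXn2r ?nnegrE ?ge_min ?lexx // le_min u0 ler01.
Qed.

Lemma clip_large (R : realType) (u : R) : 0 <= u -> ((1 < u)%R%:R : R) <= clip u.
Proof.
move=> u0; case: ltP => h; last by have /andP[] := clip_itv _ _ u0.
by rewrite /clip min_r ?expr1n // ltW.
Qed.

Lemma phi_le_clip (R : realType) (u : R) :
  0 <= u -> phi u <= clip u + u * (1 < u)%R%:R.
Proof.
move=> u0; case: ltP => h.
  rewrite (phi_ge1 _ _ (ltW h)) mulr1 lerDr; by have /andP[] := clip_itv _ _ u0.
by rewrite phi_le1 ?u0 ?h // mulr0 addr0 /clip min_l.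
Qed.

(** The left side is a parabola in s that touches the square root at s = r^2: with v = sqrt s / r
    the gap is proportional to v (1 - v)^2 (2 + v). *)
Lemma sqrt_ge_quadratic (R : realType) (s r : R) : 0 <= s -> 0 < r ->
  s / r * (3 / 2) - s ^+ 2 / (2 * r ^+ 3) <= Num.sqrt s.
Proof.
move=> s0 r0; rewrite -[in leLHS](sqr_sqrtr s0).
set u := Num.sqrt s; have u0 : 0 <= u by rewrite sqrtr_ge0.
have rN0 : r != 0 by rewrite gt_eqF.
rewrite -subr_ge0.
have -> : u - (u ^+ 2 / r * (3 / 2) - (u ^+ 2) ^+ 2 / (2 * r ^+ 3)) =
      u * (2 - 3 * (u / r) + (u / r) ^+ 3) / 2 by field.
have : 0 <= u / r by rewrite divr_ge0 // ltW.
set v := u / r => v0; rewrite divr_ge0 ?mulr_ge0 //.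
have -> : 2 - 3 * v + v ^+ 3 = (1 - v) ^+ 2 * (2 + v) by ring.
by rewrite mulr_ge0 ?sqr_ge0 // addr_ge0.
Qed.

(* At most one term on the left is positive unless two of the [y i] exceed 1,
   and then every term is nonpositive. *)
Lemma sum_large_le_l2 (R : realType) (I : finType) (y : I -> R) :
  (forall i, 0 <= y i) ->
  \sum_i y i * (1 < y i)%R%:R * (1 - \sum_(j | j != i) (1 < y j)%R%:R) <=
    Num.sqrt (\sum_i y i ^+ 2).
Proof.
move=> y0.
have [[i yi]|noi] := pselect (exists i, 1 < y i); last first.
  rewrite big1 ?sqrtr_ge0 // => i _; case: ltP => h.
    by exfalso; apply: noi; exists i.
  by rewrite mulr0 mul0r.
have [[j /andP[ji yj]]|noj] := pselect (exists j, (j != i) && (1 < y j)).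
  apply: (@le_trans _ _ 0); last exact: sqrtr_ge0.
  apply: sumr_le0 => k _.
  rewrite -mulrA mulr_ge0_le0 //.
  case: ltP => [yk|_]; last by rewrite mul0r.
  rewrite mul1r subr_le0.
  have [l lk yl] : exists2 l, l != k & 1 < y l.
    by have [ki|ki] := eqVneq i k; [exists j => //; rewrite -ki | exists i].
  by rewrite (bigD1 l) //= yl lerDl sumr_ge0.
rewrite (bigD1 i) //= [X in _ + X]big1 ?addr0 => [|j ji]; last first.
  case: ltP => h; last by rewrite mulr0 mul0r.
  by exfalso; apply: noj; exists j; rewrite ji.
rewrite yi big1 => [|j ji]; last first.
  by case: ltP => // h; exfalso; apply: noj; exists j; rewrite ji.
rewrite subr0 !mulr1 -[leLHS]ger0_norm // -sqrtr_sqr ler_wsqrtr //.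
by rewrite (bigD1 i) //= lerDl sumr_ge0 // => j _; rewrite sqr_ge0.
Qed.

(** Let A be the total mean of the clipped squares. If A >= 1/16, a second moment argument applies
    to their sum S. Otherwise the entries above 1 carry at least 1/16 of the given sum, and the
    probability that another entry also exceeds 1 is at most A < 1/16, so 15/16 of their
    contribution survives. *)
Lemma mean_l2_ge (R : realType) (I V : finType) (p : V -> R) (h : I -> V -> R) :
  pweight p -> (forall i v, 0 <= h i v) ->
  8^-1 <= \sum_i mean p (fun v => phi (h i v)) ->
  18^-1 <= mean (prodw I p) (fun o => Num.sqrt (\sum_i h i (o i) ^+ 2)).
Proof.
move=> pp h0 hS; have pw := prodw_pweight R I V p pp.
pose z i := mean p (fun v => clip (h i v)).
have z0 i : 0 <= z i.
  by apply: mean_ge0 => // v; have /andP[] := clip_itv _ _ (h0 i v).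
pose A := \sum_i z i; have A0 : 0 <= A by apply: sumr_ge0.
have [Abig|Asmall] := leP 16^-1 A.
  pose S (o : {ffun I -> V}) := \sum_i clip (h i (o i)).
  have ES : mean (prodw I p) S = A.
    by rewrite mean_sum; apply: eq_bigr => i _; rewrite (mean_coord _ _ _ _ (fun v
        => clip (h i v))).
  (* Diagonal terms use clip^2 <= clip, off-diagonal ones factor by independence. *)
  have ES2 : mean (prodw I p) (fun o => S o ^+ 2) <= A + A ^+ 2.
    have -> : mean (prodw I p) (fun o => S o ^+ 2) = \sum_i \sum_j
       mean (prodw I p) (fun o => clip (h i (o i)) * clip (h j (o j))).
      transitivity (mean (prodw I p) (fun o => \sum_i \sum_j clip (h i (o i)) *
          clip (h j (o j)))).
        apply: eq_mean => o; rewrite expr2 mulr_suml.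
        by apply: eq_bigr => i _; rewrite mulr_sumr.
      by rewrite mean_sum; apply: eq_bigr => i _; rewrite mean_sum.
    have -> : A + A ^+ 2 = \sum_i (z i + \sum_j z i * z j).
      by rewrite big_split /= expr2 mulr_suml; congr (_ + _); apply: eq_bigr => i
          _; rewrite mulr_sumr.
    apply: ler_sum => i _; rewrite (bigD1 i) //=; apply: lerD.
      rewrite (mean_coord _ _ _ _ (fun v => clip (h i v) * clip (h i v))) //.
      apply: ler_mean => // v; have /andP[c0 c1] := clip_itv _ _ (h0 i v).
      by rewrite ler_piMr.
    rewrite [leRHS](bigD1 i) //=; apply: ler_wpDl; first exact: mulr_ge0.
    apply: ler_sum => j ji.
    by rewrite (mean_coord2 _ _ _ _ (fun v => clip (h i v)) (fun v => clip (h j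
        v))) // eq_sym.
  (* The touching point r^2 = 1 + A bounds the ratio of the second to the first moment of S; the
     parabola then has mean at least 3 A / (2 r) - A / (2 r) = A / r. *)
  pose r := Num.sqrt (1 + A).
  have r2 : r ^+ 2 = 1 + A by rewrite sqr_sqrtr // addr_ge0.
  have r0 : 0 < r by rewrite sqrtr_gt0 ltr_pwDl.
  have S0 o : 0 <= S o.
    by apply: sumr_ge0 => i _; have /andP[] := clip_itv _ _ (h0 i (o i)).
  apply: (@le_trans _ _ (mean (prodw I p) (fun o => (3 / 2 / r) * S o - (2 * r ^+
      3)^-1 * S o ^+ 2))).
    rewrite meanB !meanZ ES.
    have : (2 * r ^+ 3)^-1 * mean (prodw I p) (fun o => S o ^+ 2) <=
           (2 * r ^+ 3)^-1 * (A + A ^+ 2).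
      by rewrite ler_wpM2l // invr_ge0 mulr_ge0 // exprn_ge0 // ltW.
    have -> : (2 * r ^+ 3)^-1 * (A + A ^+ 2) = A / (2 * r).
      have -> : A + A ^+ 2 = A * r ^+ 2 by rewrite r2; ring.
      by field; rewrite gt_eqF.
    have -> : 3 / 2 / r * A = A / (2 * r) * 3 by field; rewrite gt_eqF.
    suff : 18^-1 <= A / (2 * r) * 2 by lra.
    rewrite (_ : _ * 2 = A / r); last by field; rewrite gt_eqF.
    rewrite ler_pdivlMr //.
    nra.
  apply: ler_mean => // o; apply: le_trans (_ : Num.sqrt (S o) <= _).
    apply: le_trans (sqrt_ge_quadratic _ _ _ (S0 o) r0).
    by rewrite le_eqVlt; apply/orP; left; apply/eqP; field; rewrite gt_eqF.
  by apply: ler_wsqrtr; apply: ler_sum => i _; apply: clip_le_sqr.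
pose q i := mean p (fun v => (1 < h i v)%R%:R : R).
pose W i := mean p (fun v => h i v * (1 < h i v)%R%:R).
have q0 i : 0 <= q i by apply: mean_ge0.
have W0 i : 0 <= W i by apply: mean_ge0 => // v; rewrite mulr_ge0.
have qz i : q i <= z i by apply: ler_mean => // v; apply: clip_large.
have WA : 8^-1 <= A + \sum_i W i.
  apply: le_trans hS _; rewrite -big_split; apply: ler_sum => i _ /=.
  by rewrite -meanD; apply: ler_mean => // v; apply: phi_le_clip.
(* This sum is the mean of the left side of [sum_large_le_l2], computed with independence of
   distinct coordinates. *)
apply: (@le_trans _ _ (\sum_i W i * (1 - \sum_(j | j != i) q j))).
  apply: (@le_trans _ _ (\sum_i W i * (15 / 16))).
    by rewrite -mulr_suml; lra.
  apply: ler_sum => i _; apply: ler_wpM2l => //.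
  suff : \sum_(j | j != i) q j <= A by lra.
  apply: (@le_trans _ _ (\sum_j q j)); last exact: ler_sum.
  by rewrite [leRHS](bigD1 i) //= lerDr.
apply: (@le_trans _ _ (mean (prodw I p) (fun o => \sum_i h i (o i) *
   (1 < h i (o i))%R%:R * (1 - \sum_(j | j != i) (1 < h j (o j))%R%:R)))); last first.
  by apply: ler_mean => // o; apply: (@sum_large_le_l2 _ _ (fun i => h i (o i))).
rewrite mean_sum; apply: ler_sum => i _.
under [leRHS]eq_mean do rewrite mulrBr mulr1.
rewrite meanB (mean_coord _ _ _ _ (fun v => h i v * (1 < h i v)%R%:R)) // mulrBr mulr1.
rewrite lerD2l lerN2 mulr_sumr.
under eq_mean do rewrite mulr_sumr big_mkcond.
rewrite mean_sum [leRHS]big_mkcond; apply: ler_sum => j _.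
case: eqVneq => [->|ji] /=.
  by rewrite mean_cst.
rewrite (mean_coord2 _ _ _ _ (fun v => h i v * (1 < h i v)%R%:R) (fun v => (1 < h j
    v)%R%:R)) //.
by rewrite eq_sym.
Qed.

(** * Concave regularization and the law of the random factor *)

(** A discrete Green formula with kernel min (j, l). In the induction on j the kernel grows by the
    indicator of j < l, and the resulting sum of second differences telescopes. *)
Lemma sum_second_difference (R : realType) (w : nat -> R) (n j : nat) :
  (j <= n)%N ->
  \sum_(1 <= l < n.+1) (2 * w l - w l.-1 - w l.+1) * (minn j l)%:R =
  w j - w 0%N - j%:R * (w n.+1 - w n).
Proof.
elim: j => [_|j IH jn].
  rewrite mul0r !subr0 subrr big1 // => l _.
  by rewrite min0n mulr0.
transitivity (\sum_(1 <= l < n.+1) (2 * w l - w l.-1 - w l.+1) * (minn j l)%:R +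
   \sum_(1 <= l < n.+1) (2 * w l - w l.-1 - w l.+1) * (j < l)%N%:R).
  rewrite -big_split; apply: eq_bigr => l _ /=.
  rewrite -mulrDr -natrD; congr (_ * _%:R).
  by rewrite /minn; case: (ltngtP j.+1 l); case: (ltngtP j l) => //=; lia.
rewrite (IH (ltnW jn)) (@big_cat_nat _ _ _ j.+1) //=; last exact: leqW.
rewrite [X in _ + (X + _)]big_nat_cond big1 ?add0r; last first.
  by move=> l /andP[/andP[_ lj] _]; rewrite ltnNge -ltnS lj mulr0.
rewrite (eq_big_nat _ _ (F2 := fun l => (w l - w l.+1) - (w l.-1 - w l.-1.+1)));
    last first.
  move=> l /andP[jl _]; rewrite jl mulr1.
  by case: l jl => // l _ /=; ring.
rewrite (@telescope_sumr_eq _ _ _ (fun l => w l.-1 - w l.-1.+1)).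
- rewrite /= -natr1; ring.
- exact: leqW.
- by move=> l /andP[_ _]; case: l.
Qed.

(* The least of the affine functions [j |-> psi k * (1 + j / k)] is concave and
   lies between [psi] and [2 * psi]. *)
Lemma quasiconcave_regularization (R : realType) (n : nat) (psi : nat -> R) :
  (0 < n)%N ->
  (forall k, 0 <= psi k) ->
  (forall k l, (0 < k <= l)%N -> (l <= n)%N -> psi k <= psi l) ->
  (forall k l, (0 < k <= l)%N -> (l <= n)%N -> psi l * k%:R <= psi k * l%:R) ->
  exists w : nat -> R, [/\ w 0%N = 0, w n.+1 = w n,
    forall j, (0 < j <= n)%N -> psi j <= w j <= 2 * psi j &
    forall j, (0 < j <= n)%N -> w j.-1 + w j.+1 <= 2 * w j].
Proof.
case: n => // n _ psi0 psi_mono psi_quot.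
pose F (j : nat) (k : 'I_n.+1) : R := psi k.+1 * (1 + j%:R / k.+1%:R).
pose v (j : nat) : R := F j [arg min_(k < ord0) F j k]%O.
have vF j k : v j <= F j k.
  by rewrite /v; case: arg_minP => // i _; apply.
have vE j : exists k, v j = F j k by exists [arg min_(k < ord0) F j k]%O.
have F0 j k : 0 <= F j k by rewrite mulr_ge0 // addr_ge0.
(* The minimum is set to 0 at index 0 and frozen past the last index. Both changes preserve
   concavity and remove the boundary terms of [sum_second_difference]. *)
pose w (j : nat) : R := if j == 0%N then 0 else v (minn j n.+1).
have vS j : v j <= v j.+1.
  have [k ->] := vE j.+1; apply: le_trans (vF j k) _.
  by rewrite ler_wpM2l // lerD2l ler_wpM2r // ler_nat.
exists w; split=> //.
- by rewrite /w /= minnn (minn_idPr _).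
- move=> j /andP[j0 jn]; rewrite /w gtn_eqF // (minn_idPl jn); apply/andP; split.
    have [k ->] := vE j; rewrite /F.
    have [kj|jk] := leqP k.+1 j.
      apply: (@le_trans _ _ (psi k.+1 * (j%:R / k.+1%:R))).
        rewrite mulrA ler_pdivlMr //; apply: psi_quot => //.
      by rewrite ler_wpM2l // lerDr.
    apply: (@le_trans _ _ (psi k.+1)).
      by apply: psi_mono; [rewrite j0 ltnW | exact: ltn_ord].
    by rewrite ler_peMr // lerDl divr_ge0.
  have jn' : (j.-1 < n.+1)%N by rewrite prednK.
  have := vF j (Ordinal jn'); rewrite /F /= prednK // divff ?pnatr_eq0 ?gtn_eqF //.
  by rewrite mulrC.
- move=> [//|j] /= jn; rewrite /w /= !(minn_idPl jn) .
  have [jN|jN] := eqVneq j n.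
    subst j; rewrite (minn_idPr (leqnSn n.+1)) (minn_idPl (leqnSn n)).
    rewrite [leRHS](_ : _ = v n.+1 + v n.+1) ?lerD2r; last by ring.
    by case: eqP => // _; have [k ->] := vE n.+1.
  have jn2 : (j.+2 <= n.+1)%N by rewrite ltn_neqAle eqSS jN.
  rewrite (minn_idPl jn2) (minn_idPl (ltnW jn)).
  have [k ->] := vE j.+1.
  case: eqP => [->|_].
    rewrite add0r; apply: le_trans (vF _ k) _; rewrite /F.
    rewrite mulrCA ler_wpM2l //.
    have i0 : 0 <= (k.+1%:R : R)^-1 by [].
    by move: i0; set i := _^-1 => i0; lra.
  apply: le_trans (lerD (vF _ k) (vF _ k)) _; rewrite /F.
  rewrite le_eqVlt; apply/orP; left; apply/eqP.
  by rewrite -!natr1; ring.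
Qed.

Lemma orlicz_distribution (R : realType) (n : nat) (M : R -> R) :
  (0 < n)%N ->
  (forall t, 0 <= t -> 0 <= M t) ->
  (forall s t, 0 <= s <= 1 -> 0 <= t -> M (s * t) <= s * M t) ->
  (forall s t, 0 <= s <= 1 -> 0 <= t -> s ^+ 2 * M t <= M (s * t)) ->
  4^-1 <= M 1 <= 1 ->
  exists p : 'I_n.+1 -> R, [/\ pweight p,
    8^-1 <= mean p (fun l => n%:R / l%:R) <= 1 &
    forall j, (j <= n)%N ->
      M (j%:R / n%:R) / 2 <=
        mean p (fun l => phi (j%:R / n%:R * (n%:R / l%:R))) <= M (j%:R / n%:R)].
Proof.
move=> n0 M0 Mcvx M2 /andP[M1l M1u].
have nR0 : (0 : R) < n%:R by rewrite ltr0n.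
have nRN0 : (n%:R : R) != 0 by rewrite gt_eqF.
pose psi k : R := M (k%:R / n%:R) * (n%:R / k%:R).
have kn0 (k : nat) : 0 <= k%:R / n%:R :> R by rewrite divr_ge0.
have psi0 k : 0 <= psi k by rewrite mulr_ge0 ?M0 ?divr_ge0.
have ratio (k l : nat) : (0 < k <= l)%N ->
    [/\ (0 < k%:R :> R), (0 < l%:R :> R), 0 <= (k%:R / l%:R : R) <= 1 &
      k%:R / n%:R = k%:R / l%:R * (l%:R / n%:R) :> R].
  move=> /andP[k0 kl]; have l0 := leq_trans k0 kl.
  have kR : (0 : R) < k%:R by rewrite ltr0n.
  have lR : (0 : R) < l%:R by rewrite ltr0n.
  split=> //; first by rewrite divr_ge0 //= ler_pdivrMr // mul1r ler_nat.
  by field; rewrite nRN0 gt_eqF.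
have psi_mono k l : (0 < k <= l)%N -> (l <= n)%N -> psi k <= psi l.
  move=> /ratio[k0 l0 kl kE] _.
  rewrite /psi kE; apply: (@le_trans _ _ (k%:R / l%:R * M (l%:R / n%:R) * (n%:R /
      k%:R))).
    by rewrite ler_wpM2r ?divr_ge0 // Mcvx.
  by rewrite le_eqVlt; apply/orP; left; apply/eqP; field; rewrite !gt_eqF.
have psi_quot k l : (0 < k <= l)%N -> (l <= n)%N -> psi l * k%:R <= psi k * l%:R.
  move=> /ratio[k0 l0 kl kE] _.
  rewrite /psi kE; apply: (@le_trans _ _ ((k%:R / l%:R) ^+ 2 * M (l%:R / n%:R) *
      (n%:R / k%:R) * l%:R)).
    by rewrite le_eqVlt; apply/orP; left; apply/eqP; field; rewrite !gt_eqF.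
  by rewrite (ler_wpM2r (ltW l0)) // ler_wpM2r ?divr_ge0 // M2.
have [w [w0 wn wpsi wcc]] := quasiconcave_regularization _ _ _ n0 psi0 psi_mono
    psi_quot.
have green j : (j <= n)%N ->
    \sum_(1 <= l < n.+1) (2 * w l - w l.-1 - w l.+1) * (minn j l)%:R = w j.
  by move=> jn; rewrite sum_second_difference // w0 wn; ring.
pose c l := 2 * w l - w l.-1 - w l.+1.
have c0 l : (0 < l < n.+1)%N -> 0 <= c l.
  by move=> ln; rewrite /c; have := wcc l ln; lra.
(* Since phi (j / l) = j min (j, l) / l^2, this weight makes the mean of phi equal to j / (2 n)
   times the Green sum, that is j w_j / (2 n), which lies between M (j / n) / 2 and M (j / n). *)
pose q l := c l * l%:R ^+ 2 / (2 * n%:R).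
have q0 l : (0 < l < n.+1)%N -> 0 <= q l.
  by move=> ln; rewrite divr_ge0 ?mulr_ge0 ?c0 ?exprn_ge0.
have wn2 : psi n <= w n <= 2 * psi n by apply: wpsi; rewrite n0 leqnn.
have psin : psi n = M 1 by rewrite /psi divff // mulr1.
have wnE : \sum_(1 <= l < n.+1) c l * l%:R = w n.
  rewrite -(green n (leqnn n)); apply: eq_big_nat => l /andP[_ ln].
  by rewrite (minn_idPr _).
have qs : \sum_(1 <= l < n.+1) q l <= 1.
  apply: (@le_trans _ _ (\sum_(1 <= l < n.+1) c l * l%:R / 2)).
    apply: ler_sum_nat => l /andP[l0 ln].
    rewrite /q ler_pdivrMr ?mulr_gt0 //.
    rewrite (_ : _ * (2 * _) = c l * l%:R * n%:R); last by field.
    rewrite expr2 mulrA; apply: ler_wpM2l; last by rewrite ler_nat.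
    by rewrite mulr_ge0 // c0 // l0.
  rewrite -mulr_suml wnE; lra.
(* The missing mass goes to l = 0, where n / l is 0 because the inverse of 0 is 0, so it contributes
   to neither mean. *)
pose p (l : 'I_n.+1) : R :=
  if l == 0%N :> nat then 1 - \sum_(1 <= k < n.+1) q k else q l.
have pE (g : nat -> R) : \sum_(l < n.+1) p l * g l =
    (1 - \sum_(1 <= k < n.+1) q k) * g 0%N + \sum_(1 <= l < n.+1) q l * g l.
  rewrite big_ord_recl /= /p /=; congr (_ + _).
  by rewrite big_add1 big_mkord; apply: eq_bigr.
have meanE (g : nat -> R) : g 0%N = 0 ->
    mean p (fun l => g l) = \sum_(1 <= l < n.+1) q l * g l.
  by move=> g0; rewrite /mean pE g0 mulr0 add0r.
exists p; split.
- split=> [l|]; last first.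
    have := pE (fun=> 1); rewrite mulr1.
    under eq_bigr do rewrite mulr1.
    under [X in _ = _ + X -> _]eq_bigr do rewrite mulr1.
    by move=> ->; rewrite subrK.
  rewrite /p; case: eqP => [_|/eqP l0]; first by rewrite subr_ge0.
  by apply: q0; rewrite lt0n l0 ltn_ord.
- rewrite (meanE (fun l => n%:R / l%:R)) ?invr0 ?mulr0 //.
  rewrite (_ : \sum_(_ <= _ < _) _ = w n / 2); first lra.
  rewrite -wnE mulr_suml; apply: eq_big_nat => l /andP[l0 ln].
  by rewrite /q; field; rewrite nRN0 pnatr_eq0 -lt0n l0.
- move=> j jn; rewrite (meanE (fun l => phi (j%:R / n%:R * (n%:R / l%:R)))); last first.
    by rewrite invr0 !mulr0 /phi expr0n min_l.
  have [->|j0] := posnP j.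
    rewrite mul0r big1 => [|l _]; last first.
      by rewrite mul0r /phi expr0n min_l // mulr0.
    have := Mcvx 0 0; rewrite !mul0r lexx ler01 => /(_ isT isT) h.
    have := M0 0 (lexx 0); lra.
  have jR : (0 : R) < j%:R by rewrite ltr0n.
  rewrite (_ : \sum_(_ <= _ < _) _ = w j * j%:R / (2 * n%:R)); last first.
    rewrite -(green j jn) !mulr_suml; apply: eq_big_nat => l /andP[l0 ln].
    have lR : (0 : R) < l%:R by rewrite ltr0n.
    rewrite (_ : _ / n%:R * _ = j%:R / l%:R); last by field; rewrite nRN0 gt_eqF.
    rewrite /q -/(c l); have [jl|lj] := leqP j l.
      rewrite phi_le1 ?divr_ge0 //=; last by rewrite ler_pdivrMr // mul1r ler_nat.
      by field; rewrite nRN0 gt_eqF.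
    rewrite phi_ge1; last by rewrite ler_pdivlMr // mul1r ler_nat ltnW.
    by field; rewrite nRN0 gt_eqF.
  have /andP[wl wu] : psi j <= w j <= 2 * psi j by apply: wpsi; rewrite j0.
  have -> : M (j%:R / n%:R) = psi j * j%:R / n%:R.
    by rewrite /psi; field; rewrite nRN0 gt_eqF.
  have a0 : 0 <= (j%:R / n%:R : R) by [].
  rewrite (_ : _ / (2 * _) = w j / 2 * (j%:R / n%:R)); last by field.
  rewrite (_ : _ / _ / 2 = psi j / 2 * (j%:R / n%:R)); last by field.
  rewrite -[X in _ && (_ <= X)]mulrA !ler_wpM2r //; lra.
Qed.

(** * Comparison of the averaged norm with the Luxemburg norm *)

Lemma cauchy_schwarz_weighted (R : realType) (I : finType) (x b : I -> R) :
  (\sum_i x i ^+ 2 * b i) ^+ 2 <=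
    (\sum_i x i ^+ 2) * \sum_i (x i * b i) ^+ 2.
Proof.
set q := \sum_i _ ^+ 2; set A := \sum_i _ * _; set S := \sum_i (_ * _) ^+ 2.
have q0 : 0 <= q by apply: sumr_ge0 => i _; rewrite sqr_ge0.
have [qz|qN0] := eqVneq q 0.
  have x0 i : x i ^+ 2 = 0.
    apply/eqP; rewrite eq_le sqr_ge0 andbT -qz /q (bigD1 i) //= lerDl.
    by apply: sumr_ge0 => j _; rewrite sqr_ge0.
  by rewrite /A big1 ?expr0n ?qz ?mul0r // => i _; rewrite x0 mul0r.
have qp : 0 < q by rewrite lt_def qN0.
(* A / q is the mean of b under the weights x_i^2 / q; the inequality is the nonnegativity of the
   variance. *)
have : 0 <= \sum_i x i ^+ 2 * (b i - A / q) ^+ 2.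
  by apply: sumr_ge0 => i _; rewrite mulr_ge0 ?sqr_ge0.
have -> : \sum_i x i ^+ 2 * (b i - A / q) ^+ 2 = S - 2 * (A / q) * A + (A / q) ^+ 2 * q.
  transitivity (\sum_i ((x i * b i) ^+ 2 - 2 * (A / q) * (x i ^+ 2 * b i) + (A / q)
      ^+ 2 * x i ^+ 2)).
    by apply: eq_bigr => i _; ring.
  by rewrite big_split sumrB -!mulr_sumr.
have -> : S - 2 * (A / q) * A + (A / q) ^+ 2 * q = S - A ^+ 2 / q by field.
by rewrite subr_ge0 ler_pdivrMr // mulrC.
Qed.

(** Cauchy-Schwarz bounds the Euclidean norm of (x_i b_i) below by its inner product with x / |x|_2,
    which is linear in the b_i and can be averaged exactly. *)
Lemma mean_l2_ge_l2 (R : realType) (I V : finType) (p b : V -> R) (x : I -> R) :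
  pweight p -> (forall v, 0 <= b v) ->
  Num.sqrt (\sum_i x i ^+ 2) * mean p b <=
    mean (prodw I p) (fun o => Num.sqrt (\sum_i (x i * b (o i)) ^+ 2)).
Proof.
move=> pp b0; have pw := prodw_pweight R I V p pp.
set q := \sum_i _; have q0 : 0 <= q by apply: sumr_ge0 => i _; rewrite sqr_ge0.
set r := Num.sqrt q; have r0 : 0 <= r by rewrite sqrtr_ge0.
have r2 : r ^+ 2 = q by rewrite sqr_sqrtr.
have [->|rN0] := eqVneq r 0.
  by rewrite mul0r; apply: mean_ge0 => // o; rewrite sqrtr_ge0.
have rp : 0 < r by rewrite lt_def rN0.
have pt (o : {ffun I -> V}) : r^-1 * \sum_i x i ^+ 2 * b (o i) <=
    Num.sqrt (\sum_i (x i * b (o i)) ^+ 2).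
  rewrite mulrC ler_pdivrMr // -[leLHS]ger0_norm; last first.
    by apply: sumr_ge0 => i _; rewrite mulr_ge0 ?sqr_ge0.
  rewrite -[X in _ <= _ * X]ger0_norm // -2!sqrtr_sqr -sqrtrM ?ler_wsqrtr //; last
      first.
    by apply: sumr_ge0 => i _; rewrite sqr_ge0.
  rewrite r2 mulrC; apply: cauchy_schwarz_weighted.
apply: le_trans (ler_mean _ _ _ _ _ pw pt).
rewrite meanZ mean_sum (_ : \sum_i _ = q * mean p b); last first.
  rewrite mulr_suml; apply: eq_bigr => i _.
  by rewrite meanZ (mean_coord _ _ _ _ b).
by rewrite -r2 (_ : _ * _ = r^-1 * (r ^+ 2 * mean p b)) //; field.
Qed.

Lemma orlicz_mono (R : realType) (M : R -> R) (s t : R) :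
  (forall t, 0 <= t -> 0 <= M t) ->
  (forall s t, 0 <= s <= 1 -> 0 <= t -> M (s * t) <= s * M t) ->
  0 <= s <= t -> M s <= M t.
Proof.
move=> M0 Mcvx /andP[s0 st]; have t0 := le_trans s0 st.
have [tz|tN0] := eqVneq t 0.
  by have -> : s = t; [apply/eqP; rewrite eq_le st tz | ].
have tp : 0 < t by rewrite lt_def tN0.
have st1 : 0 <= s / t <= 1 by rewrite divr_ge0 //= ler_pdivrMr // mul1r.
have := Mcvx _ _ st1 t0; rewrite divfK // => /le_trans; apply.
by rewrite ler_piMl ?M0 //; case/andP: st1.
Qed.

(** For k >= 1 half of (k + 1) / n is at most k / n, and halving the argument divides M by at most
    4. For k = 0 the first grid value is at most M 1 / n. *)
Lemma orlicz_grid (R : realType) (M : R -> R) (n k : nat) :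
  (0 < n)%N ->
  (forall t, 0 <= t -> 0 <= M t) ->
  (forall s t, 0 <= s <= 1 -> 0 <= t -> M (s * t) <= s * M t) ->
  (forall s t, 0 <= s <= 1 -> 0 <= t -> s ^+ 2 * M t <= M (s * t)) ->
  M 1 <= 1 ->
  M (k.+1%:R / n%:R) <= 4 * M (k%:R / n%:R) + n%:R^-1.
Proof.
move=> n0 M0 Mcvx M2 M1.
have nR0 : (0 : R) < n%:R by rewrite ltr0n.
case: k => [|k].
  have : 0 <= (n%:R^-1 : R) <= 1.
    by rewrite invr_ge0 ltW //= invf_le1 // ler1n.
  move=> /Mcvx/(_ ler01); rewrite !mulr1 mul1r => /le_trans; apply.
  have := M0 (0%:R / n%:R); rewrite mul0r lexx => /(_ isT) h.
  have : n%:R^-1 * M 1 <= n%:R^-1 by rewrite ler_piMr // invr_ge0 ltW.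
  lra.
have h12 : 0 <= (2^-1 : R) <= 1 by apply/andP; split; lra.
have kn0 : 0 <= k.+2%:R / n%:R :> R by rewrite divr_ge0.
have := M2 _ _ h12 kn0.
have : M (2^-1 * (k.+2%:R / n%:R)) <= M (k.+1%:R / n%:R).
  apply: orlicz_mono => //; rewrite mulr_ge0 //= mulrA ler_wpM2r ?invr_ge0 //.
  rewrite ler_pdivrMl // -natrM ler_nat; lia.
have : 0 <= (n%:R^-1 : R) by rewrite invr_ge0.
lra.
Qed.

(** The norm of a linear combination in L1 of a finite weighted space. It covers both the averaged
    norm T and, with uniform weight on the samples, its empirical version. *)
Definition L1comb {R : realType} {I T : finType} (w : T -> R) (F : I -> T -> R)
  (x : I -> R) : R := mean w (fun t => `|\sum_i x i * F i t|).

Lemma L1comb_ge0 (R : realType) (I T : finType) (w : T -> R) (F : I -> T -> R)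
    (x : I -> R) : pweight w -> 0 <= L1comb w F x.
Proof. by move=> pw; apply: mean_ge0. Qed.

Lemma L1combD (R : realType) (I T : finType) (w : T -> R) (F : I -> T -> R)
    (x y : I -> R) :
  pweight w -> L1comb w F (fun i => x i + y i) <= L1comb w F x + L1comb w F y.
Proof.
move=> pw; rewrite -meanD; apply: ler_mean => // t.
apply: le_trans (ler_normD _ _); rewrite le_eqVlt; apply/orP; left; apply/eqP.
by congr `|_|; rewrite -big_split; apply: eq_bigr => i _; rewrite mulrDl.
Qed.

Lemma L1combZ (R : realType) (I T : finType) (w : T -> R) (F : I -> T -> R)
    (a : R) (x : I -> R) :
  L1comb w F (fun i => a * x i) = `|a| * L1comb w F x.
Proof.
rewrite -meanZ; apply: eq_mean => t; rewrite -normrM mulr_sumr; congr `|_|.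
by apply: eq_bigr => i _; rewrite mulrA.
Qed.

Lemma L1comb_le (R : realType) (I T : finType) (w : T -> R) (F : I -> T -> R)
    (x : I -> R) :
  pweight w -> L1comb w F x <= \sum_i `|x i| * mean w (fun t => `|F i t|).
Proof.
move=> pw; under [leRHS]eq_bigr do rewrite -meanZ.
rewrite -mean_sum; apply: ler_mean => // t; apply: le_trans (ler_norm_sum _ _ _) _.
by apply: ler_sum => i _; rewrite normrM.
Qed.

(* The random vector with independent coordinates [eps_i * f_i], where the signs
   [eps_i] are uniform and the [f_i] follow the law of [orlicz_distribution]. *)
Lemma orlicz_random_vector (R : realType) (n : nat) (M : R -> R) :
  (0 < n)%N ->
  (forall t, 0 <= t -> 0 <= M t) ->
  (forall s t, 0 <= s <= 1 -> 0 <= t -> M (s * t) <= s * M t) ->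
  (forall s t, 0 <= s <= 1 -> 0 <= t -> s ^+ 2 * M t <= M (s * t)) ->
  4^-1 <= M 1 <= 1 ->
  exists (T : finType) (w : T -> R) (F : 'I_n -> T -> R),
    [/\ pweight w,
      (forall i t, `|F i t| <= n%:R) /\ (forall i, mean w (fun t => `|F i t|) <= 1),
      forall x : 'I_n -> R,
        Num.sqrt (\sum_i x i ^+ 2) / 16 <= L1comb w F x,
      forall x : 'I_n -> R, \sum_i M (`|x i| / 2) <= 1 ->
        L1comb w F x <= 88 &
      forall x : 'I_n -> R, L1comb w F x < 36^-1 ->
        \sum_i M (`|x i| / 2) <= 1].
Proof.
rewrite /L1comb.
move=> n0 M0 Mcvx M2 M1.
have nR0 : (0 : R) < n%:R by rewrite ltr0n.
have [p [pp /andP[mu_ge mu_le] pM]] := orlicz_distribution _ _ _ n0 M0 Mcvx M2 M1.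
have /andP[_ M11] := M1.
pose b (l : 'I_n.+1) : R := n%:R / l%:R.
have b0 l : 0 <= b l by rewrite divr_ge0.
have pw := prodw_pweight _ 'I_n _ _ pp.
pose T := ({ffun 'I_n -> 'I_n.+1} * {ffun 'I_n -> bool})%type.
pose w (t : T) : R := prodw 'I_n p t.1 * signw 'I_n t.2.
pose F i (t : T) : R := (-1) ^+ t.2 i * b (t.1 i).
have ww : pweight w by apply: pweight_pair => //; apply: signw_pweight.
have normF i t : `|F i t| = b (t.1 i).
  by rewrite normrM normrX normrN1 expr1n mul1r ger0_norm.
have TE (x : 'I_n -> R) : mean w (fun t => `|\sum_i x i * F i t|) =
    mean (prodw 'I_n p) (fun o => rademacher_norm (fun i => x i * b (o i))).
  rewrite mean_pair; apply: eq_mean => o; apply: eq_mean => s.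
  by congr `|_|; apply: eq_bigr => i _; rewrite /F /=; ring.
have Tlow (x : 'I_n -> R) :
    mean (prodw 'I_n p) (fun o => Num.sqrt (\sum_i (x i * b (o i)) ^+ 2)) / 2 <=
    mean w (fun t => `|\sum_i x i * F i t|).
  rewrite TE mulrC -meanZ; apply: ler_mean => // o.
  by rewrite mulrC; apply: khintchine.
have Tl2 (x : 'I_n -> R) :
    Num.sqrt (\sum_i x i ^+ 2) / 16 <= mean w (fun t => `|\sum_i x i * F i t|).
  apply: le_trans (Tlow x).
  have := mean_l2_ge_l2 _ _ _ _ b x pp b0.
  set r := Num.sqrt (\sum_i x i ^+ 2) => h.
  have : r * 8^-1 <= r * mean p b by rewrite ler_wpM2l // sqrtr_ge0.
  lra.
have trunc_bounds (t : R) : 0 <= t ->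
    (Num.truncn (n%:R * t))%:R / n%:R <= t < (Num.truncn (n%:R * t)).+1%:R / n%:R.
  move=> t0; have := truncn_itv (mulr_ge0 (ltW nR0) t0).
  by rewrite ler_pdivrMr // ltr_pdivlMr // [t * _]mulrC.
have grid_sum : \sum_(i < n) (n%:R^-1 : R) = 1.
  by rewrite sumr_const card_ord -[LHS]mulr_natr mulVf // gt_eqF.
exists T, w, F; split => //.
- split=> i => [t|].
    rewrite normF /b; have [->|l0] := posnP (t.1 i : nat).
      by rewrite invr0 mulr0 ltW.
    by rewrite ler_pdivrMr ?ltr0n // ler_peMr ?ler1n // ltW.
  under eq_mean do rewrite normF.
  rewrite mean_pair.
  under eq_mean => o do rewrite /= (mean_cst _ _ _ _ (signw_pweight _ _)).
  by rewrite (mean_coord _ _ _ _ b).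
- move=> x xM.
  (* As M u >= u / 4 for u >= 1, the hypothesis gives |x_i| <= 8, so |y_i| <= 1/2 and the next grid
     point above |y_i| is still at most 1. The bound 1/2 + 4 + 1 for y becomes 88 for x. *)
  pose y i := x i / 16.
  have xu i : `|x i| <= 8.
    have : M (`|x i| / 2) <= 1.
      apply: le_trans xM; rewrite (bigD1 i) //= lerDl sumr_ge0 // => j _.
      by rewrite M0 // divr_ge0.
    rewrite leNgt => h1; rewrite leNgt; apply/negP => x8; move: h1; apply/negP;
        rewrite negbK.
    have h : 0 <= (`|x i| / 2)^-1 <= 1 by rewrite invr_ge0 divr_ge0 //= invf_le1; lra.
    have := Mcvx _ (`|x i| / 2) h; rewrite mulVf; last by rewrite gt_eqF; lra.
    rewrite divr_ge0 // => /(_ isT).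
    rewrite mulrC ler_pdivlMr; last lra.
    nra.
  have -> : mean w (fun t => `|\sum_i x i * F i t|) =
      16 * mean w (fun t => `|\sum_i y i * F i t|).
    rewrite -meanZ; apply: eq_mean => t.
    rewrite -[in RHS](@ger0_norm _ 16) // -normrM; congr `|_|; rewrite mulr_sumr.
    by apply: eq_bigr => i _; rewrite /y; field.
  suff : mean w (fun t => `|\sum_i y i * F i t|) <= 2^-1 + 5 by lra.
  rewrite TE; pose k i := Num.truncn (n%:R * `|y i|).
  have yE i : `|y i| = `|x i| / 16 by rewrite normrM normfV (ger0_norm (_ : 0 <= 16)).
  have kn i : (k i < n)%N.
    have /andP[h _] := trunc_bounds _ (normr_ge0 (y i)).
    rewrite -(ltr_nat R) -[ltRHS]mul1r -ltr_pdivrMr //; apply: le_lt_trans h _.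
    by have := xu i; rewrite yE; lra.
  apply: (@le_trans _ _ (mean (prodw 'I_n p) (fun o => 2^-1 + \sum_i phi ((k
      i).+1%:R / n%:R * b (o i))))).
    apply: ler_mean => // o; apply: le_trans (rademacher_norm_le_phi _ _ _) _.
    rewrite lerD2l; apply: ler_sum => i _; apply: phi_mono.
    rewrite normr_ge0 normrM (ger0_norm (b0 _)) ler_wpM2r //.
    by have /andP[_ /ltW] := trunc_bounds _ (normr_ge0 (y i)).
  rewrite meanD mean_cst // lerD2l mean_sum.
  apply: (@le_trans _ _ (\sum_i (4 * M (`|x i| / 2) + n%:R^-1))).
    apply: ler_sum => i _.
    rewrite (mean_coord _ _ _ _ (fun l => phi ((k i).+1%:R / n%:R * b l))) //.
    have /andP[_ h] := pM _ (kn i); apply: le_trans h _.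
    apply: le_trans (orlicz_grid _ _ _ _ n0 M0 Mcvx M2 M11) _.
    rewrite lerD2r ler_wpM2l //; apply: orlicz_mono => //.
    rewrite divr_ge0 //=.
    have /andP[h' _] := trunc_bounds _ (normr_ge0 (y i)).
    apply: le_trans h' _; rewrite yE; have := normr_ge0 (x i); lra.
  rewrite big_split /= -mulr_sumr grid_sum; lra.
- move=> x xT; rewrite leNgt; apply/negP => xM.
  (* The Euclidean lower bound gives |x|_2 < 16 / 36, which keeps the coordinates in the range of
     the grid. *)
  have xu i : `|x i| <= 1.
    have : `|x i| <= Num.sqrt (\sum_i x i ^+ 2).
      rewrite -sqrtr_sqr ler_wsqrtr // (bigD1 i) //= lerDl sumr_ge0 // => j _.
      by rewrite sqr_ge0.
    have := Tl2 x; lra.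
  pose k i := Num.truncn (n%:R * `|x i|).
  have kn i : (k i <= n)%N.
    have /andP[h _] := trunc_bounds _ (normr_ge0 (x i)).
    rewrite -(ler_nat R) -[leRHS]mul1r -ler_pdivrMr //; exact: le_trans h _.
  (* With k_i / n the grid point below |x_i|, M (|x_i| / 2) <= 2 M (k_i / n) + 1 / (2 n), so the M
     (k_i / n) sum to more than 1/4. The resulting 1/8 yields 1/18 by [mean_l2_ge] and then 1/36 by
     Khintchine, a contradiction. *)
  have : 8^-1 <= \sum_i mean p (fun l => phi (`|x i| * b l)).
    have h1 : \sum_i M (`|x i| / 2) <= \sum_i (2 * M ((k i)%:R / n%:R) + n%:R^-1 / 2).
      apply: ler_sum => i _.
      have h12 : 0 <= (2^-1 : R) <= 1 by apply/andP; split; lra.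
      have := Mcvx _ _ h12 (normr_ge0 (x i)); rewrite [_ * `|_|]mulrC.
      have := orlicz_grid _ _ _ (k i) n0 M0 Mcvx M2 M11.
      have : M `|x i| <= M ((k i).+1%:R / n%:R).
        apply: orlicz_mono => //; rewrite normr_ge0 /=.
        by have /andP[_ /ltW] := trunc_bounds _ (normr_ge0 (x i)).
      lra.
    have h2 : \sum_i M ((k i)%:R / n%:R) / 2 <= \sum_i mean p (fun l => phi (`|x i|
        * b l)).
      apply: ler_sum => i _; have /andP[h _] := pM _ (kn i).
      apply: le_trans h _; apply: ler_mean => // l; apply: phi_mono.
      rewrite mulr_ge0 ?divr_ge0 //= ler_wpM2r //.
      by have /andP[] := trunc_bounds _ (normr_ge0 (x i)).
    move: h1 h2; rewrite big_split /= -!mulr_suml -mulr_sumr grid_sum; lra.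
  move=> /(mean_l2_ge R _ _ p (fun i l => `|x i| * b l) pp (fun i l => mulr_ge0
      (normr_ge0 _) (b0 l))).
  have := Tlow x.
  under [X in _ -> _ <= X -> _]eq_mean => o.
    under eq_bigr => i _ do rewrite exprMn real_normK ?num_real // -exprMn.
    over.
  lra.
Qed.

(** * From a grid of the cube to the whole space *)

Lemma l1_le_l2 (R : realType) (n : nat) (x : 'I_n -> R) :
  \sum_i `|x i| <= Num.sqrt n%:R * Num.sqrt (\sum_i x i ^+ 2).
Proof.
have := cauchy_schwarz_weighted R 'I_n (fun=> 1) (fun i => `|x i|).
under eq_bigr do rewrite expr1n mul1r.
under [X in _ <= X * _ -> _]eq_bigr do rewrite expr1n.
under [X in _ <= _ * X -> _]eq_bigr do rewrite mul1r real_normK ?num_real //.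
rewrite sumr_const card_ord -sqrtrM // => h.
rewrite -[leLHS]ger0_norm ?sumr_ge0 // -sqrtr_sqr; exact: ler_wsqrtr.
Qed.

(** The indices 0, ..., 2 K encode the multiples of 1 / K in [-1, 1]. *)
Definition grid_point {R : realType} (n K : nat) (a : {ffun 'I_n -> 'I_(2 * K).+1})
  (i : 'I_n) : R := ((a i)%:R - K%:R) / K%:R.

Lemma grid_point_near (R : realType) (n K : nat) (x : 'I_n -> R) :
  (0 < K)%N -> (forall i, `|x i| <= 1) ->
  exists a, forall i, `|x i - grid_point n K a i| <= K%:R^-1.
Proof.
move=> K0 x1; have KR : (0 : R) < K%:R by rewrite ltr0n.
have xK i : 0 <= K%:R * (x i + 1) <= (2 * K)%:R.
  have := x1 i; rewrite ler_norml => /andP[l u].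
  have x0 : 0 <= x i + 1 by lra.
  by rewrite mulr_ge0 // natrM mulrC ler_wpM2r //; lra.
have lt i : (Num.truncn (K%:R * (x i + 1)) < (2 * K).+1)%N.
  have /andP[l u] := xK i; have /andP[h _] := truncn_itv l.
  by rewrite ltnS -(ler_nat R) (le_trans h).
exists [ffun i => Ordinal (lt i)] => i; rewrite /grid_point ffunE /=.
have /andP[l _] := xK i; have := truncn_itv l.
set k := Num.truncn _; rewrite -natr1 => /andP[h1 h2].
rewrite (_ : _ - _ = (K%:R * (x i + 1) - k%:R) / K%:R); last by field; rewrite gt_eqF.
rewrite ger0_norm; last by rewrite divr_ge0 // subr_ge0.
by rewrite ler_pdivrMr // mulVf ?gt_eqF //; lra.
Qed.

(** After normalizing the l1 norm to 1, the reference norm is at least 1 / (16 n), while rounding to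
    the grid moves the two norms by at most n / K and 4 n / K. The fineness of K makes these errors
    small enough to pass from the factor 4 to 8. *)
Lemma L1comb_net (R : realType) (n K : nat) (S T : finType) (u : S -> R)
    (G : 'I_n -> S -> R) (w : T -> R) (F : 'I_n -> T -> R) :
  (0 < n)%N -> (640 * n%:R ^+ 2 <= K%:R :> R) -> pweight u -> pweight w ->
  (forall i, mean w (fun t => `|F i t|) <= 1) ->
  (forall x : 'I_n -> R, Num.sqrt (\sum_i x i ^+ 2) / 16 <= L1comb w F x) ->
  (forall a, let z := grid_point n K a in
     L1comb w F z / 4 <= L1comb u G z <= 4 * L1comb w F z) ->
  forall x, L1comb w F x / 8 <= L1comb u G x <= 8 * L1comb w F x.
Proof.
move=> n0 nK pu pw F1 Fl2 net x.
have nR1 : (1 : R) <= n%:R by rewrite ler1n.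
have KR : (0 : R) < K%:R.
  apply: lt_le_trans nK; apply: mulr_gt0; first by rewrite ltr0n.
  by rewrite exprn_gt0 // (lt_le_trans _ nR1).
have K0 : (0 < K)%N by rewrite -(ltr0n R).
(* The unit vectors are grid points, so the comparison on the grid itself controls each coordinate
   of [G]. *)
have G4 i : mean u (fun t => `|G i t|) <= 4.
  have KK : (K < (2 * K).+1)%N by lia.
  pose a : {ffun 'I_n -> 'I_(2 * K).+1} :=
    [ffun j => if j == i then ord_max else Ordinal KK].
  have aE j : grid_point n K a j = (j == i)%:R :> R.
    rewrite /grid_point ffunE; case: eqP => _ /=; last by rewrite subrr mul0r.
    by rewrite natrM; field; rewrite gt_eqF.
  have single (T' : finType) (H : 'I_n -> T' -> R) t : \sum_j grid_point n K a j *
      H j t = H i t.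
    rewrite (bigD1 i) //= aE eqxx mul1r big1 ?addr0 // => j /negbTE ji.
    by rewrite aE ji mul0r.
  have /andP[_] := net a; rewrite /L1comb.
  under eq_mean do rewrite single.
  under [X in _ <= _ * X -> _]eq_mean do rewrite single.
  have := F1 i; lra.
pose s := \sum_i `|x i|; have s0 : 0 <= s by apply: sumr_ge0.
have [sz|sN0] := eqVneq s 0.
  have x0 i : `|x i| = 0.
    by apply/eqP; rewrite eq_le normr_ge0 andbT -sz /s (bigD1 i) //= lerDl sumr_ge0.
  have z0 (T' : finType) (v : T' -> R) (H : 'I_n -> T' -> R) : pweight v -> L1comb
      v H x = 0.
    move=> pv; apply/eqP; rewrite eq_le L1comb_ge0 // andbT.
    by apply: le_trans (L1comb_le _ _ _ _ _ _ pv) _; rewrite big1 // => i _;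
        rewrite x0 mul0r.
  by rewrite !z0 // mul0r mulr0 lexx.
have sp : 0 < s by rewrite lt_def sN0.
pose y i := s^-1 * x i.
have yn i : `|y i| = s^-1 * `|x i| by rewrite normrM ger0_norm // invr_ge0.
have y1 i : `|y i| <= 1.
  rewrite yn ler_pdivrMl // mulr1 /s (bigD1 i) //= lerDl; exact: sumr_ge0.
have ys : \sum_i `|y i| = 1.
  by under eq_bigr do rewrite yn; rewrite -mulr_sumr -/s mulVf.
have xy (T' : finType) (v : T' -> R) (H : 'I_n -> T' -> R) : L1comb v H x = s *
    L1comb v H y.
  by rewrite L1combZ normfV ger0_norm // mulrA divff // mul1r.
suff : L1comb w F y / 8 <= L1comb u G y <= 8 * L1comb w F y.
  rewrite !xy => /andP[l r]; apply/andP; split; nra.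
have Ty : 1 / (16 * n%:R) <= L1comb w F y.
  apply: le_trans (Fl2 y); have := l1_le_l2 _ _ y; rewrite ys.
  set q := Num.sqrt (\sum_i _); set r := Num.sqrt n%:R => h.
  have r0 : 0 <= r by rewrite sqrtr_ge0.
  have q0 : 0 <= q by rewrite sqrtr_ge0.
  have r2 : r ^+ 2 = n%:R by rewrite sqr_sqrtr.
  rewrite ler_pdivrMr ?mulr_gt0 ?(lt_le_trans _ nR1) //.
  have : r <= n%:R by nra.
  nra.
have [a ha] := grid_point_near R n K y K0 y1.
set z := grid_point n K a in ha; have /andP[zl zu] := net a.
rewrite -/z in zl zu.
pose d : R := n%:R / K%:R.
have dT : 40 * d <= L1comb w F y.
  apply: le_trans Ty; rewrite /d mulrA ler_pdivrMr // mulrAC ler_pdivlMr.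
    nra.
  by rewrite mulr_gt0 // (lt_le_trans _ nR1).
have near (T' : finType) (v : T' -> R) (H : 'I_n -> T' -> R) (c : R) : pweight v ->
    (forall i, mean v (fun t => `|H i t|) <= c) -> 0 <= c ->
    L1comb v H y <= L1comb v H z + c * d /\ L1comb v H z <= L1comb v H y + c * d.
  move=> pv Hc c0.
  have e : L1comb v H (fun i => y i - z i) <= c * d.
    apply: le_trans (L1comb_le _ _ _ _ _ _ pv) _.
    apply: (@le_trans _ _ (\sum_(i < n) K%:R^-1 * c)).
      by apply: ler_sum => i _; apply: ler_pM => //; apply: mean_ge0.
    by rewrite sumr_const card_ord -[leLHS]mulr_natr /d le_eqVlt; apply/orP; left;
        apply/eqP; ring.
  have e' : L1comb v H (fun i => z i - y i) <= c * d.
    have -> : (fun i => z i - y i) = (fun i => (-1) * (y i - z i)).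
      by apply/funext => i; ring.
    by rewrite L1combZ normrN1 mul1r.
  split.
    have := L1combD _ _ _ v H z (fun i => y i - z i) pv.
    have -> : (fun i => z i + (y i - z i)) = y by apply/funext => i; ring.
    lra.
  have := L1combD _ _ _ v H y (fun i => z i - y i) pv.
  have -> : (fun i => y i + (z i - y i)) = z by apply/funext => i; ring.
  lra.
have [] := near _ _ _ _ pu G4 (ler0n _ 4).
have [] := near _ _ _ _ pw F1 ler01.
move=> h1 h2 h3 h4; apply/andP; split; lra.
Qed.

(** * Chernoff bounds and random sampling *)

Lemma expR_le_1D2 (R : realType) (y : R) : 0 <= y <= 2^-1 -> expR y <= 1 + 2 * y.
Proof.
move=> /andP[y0 y1]; have := expR_ge1Dx (- y); rewrite expRN => h.
have e0 := expR_gt0 y.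
have : (1 - y) * expR y <= 1.
  by rewrite -ler_pdivlMr // div1r.
nra.
Qed.

Lemma expRN_le_1B (R : realType) (y : R) : 0 <= y <= 1 -> expR (- y) <= 1 - y / 2.
Proof.
move=> /andP[y0 y1]; have h := expR_ge1Dx y.
rewrite expRN -[leLHS]div1r ler_pdivrMr ?expR_gt0 //; nra.
Qed.

Lemma mean_expR_sum (R : realType) (T : finType) (w g : T -> R) (N : nat) :
  mean (prodw 'I_N w) (fun o => expR (\sum_k g (o k))) =
  mean w (fun t => expR (g t)) ^+ N.
Proof.
under eq_mean do rewrite expR_sum.
by rewrite (mean_prod R 'I_N T w (fun _ t => expR (g t))) prodr_const card_ord.
Qed.

Lemma two_sided_chernoff (R : realType) (T : finType) (w g : T -> R) (B : R) (N : nat) :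
  pweight w -> 0 < B -> (forall t, 0 <= g t <= B) ->
  mean (prodw 'I_N w) (fun o =>
    ((4 * (N%:R * mean w g) < \sum_k g (o k)) ||
     (\sum_k g (o k) < N%:R * mean w g / 4))%:R) <=
  2 * expR (- (N%:R * (mean w g / (8 * B)))).
Proof.
move=> pw B0 gB; set mu := mean w g.
have mu0 : 0 <= mu by apply: mean_ge0 => // t; case/andP: (gB t).
(* This parameter keeps l g in [0, 1/2], where the linear bounds on exp hold. With X = l N mu the
   tails contribute exp (- 2 X) and exp (- X / 4), and X / 4 is the exponent claimed. *)
pose l : R := (2 * B)^-1; have l0 : 0 < l by rewrite invr_gt0 mulr_gt0.
have lg t : 0 <= l * g t <= 2^-1.
  have /andP[g0 gb] := gB t; rewrite (mulr_ge0 (ltW l0)) //=.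
  by rewrite [_ * g t]mulrC /l ler_pdivrMr ?mulr_gt0 // mulrA mulVf // mul1r.
have Eup : mean (prodw 'I_N w) (fun o => expR (\sum_k l * g (o k))) <=
    expR (2 * l * mu * N%:R).
  rewrite (mean_expR_sum _ _ _ (fun t => l * g t)) expRM_natr.
  apply: lerXn2r; rewrite ?nnegrE ?expR_ge0 ?mean_ge0 //.
  apply: le_trans (expR_ge1Dx _).
  apply: (@le_trans _ _ (mean w (fun t => 1 + 2 * l * g t))).
    by apply: ler_mean => // t; rewrite -mulrA; apply: expR_le_1D2.
  by rewrite meanD meanZ mean_cst.
have Edn : mean (prodw 'I_N w) (fun o => expR (\sum_k - (l * g (o k)))) <=
    expR (- (l * mu / 2) * N%:R).
  rewrite (mean_expR_sum _ _ _ (fun t => - (l * g t))) expRM_natr.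
  apply: lerXn2r; rewrite ?nnegrE ?expR_ge0 ?mean_ge0 //.
  apply: le_trans (expR_ge1Dx _).
  apply: (@le_trans _ _ (mean w (fun t => 1 + (- (l / 2)) * g t))).
    apply: ler_mean => // t; rewrite mulNr mulrAC; apply: expRN_le_1B.
    have /andP[-> h] := lg t; lra.
  by rewrite meanD meanZ mean_cst // mulNr mulrAC.
pose C1 := expR (- (l * (4 * (N%:R * mu)))).
pose C2 := expR (l * (N%:R * mu / 4)).
apply: (@le_trans _ _ (mean (prodw 'I_N w) (fun o =>
   C1 * expR (\sum_k l * g (o k)) + C2 * expR (\sum_k - (l * g (o k)))))).
  apply: ler_mean; first exact: prodw_pweight.
  move=> o; rewrite -!expRD sumrN -mulr_sumr.
  set S := \sum_k _.
  have e1 x : 0 <= x -> 1 <= expR x :> R.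
    by move=> x0; rewrite -expR0 ler_expR.
  case: ltP => [h|_] /=.
    apply: ler_wpDr; first exact: expR_ge0.
    by apply: e1; rewrite addrC subr_ge0 ler_wpM2l ?ltW.
  case: ltP => [h|_] /=; last by rewrite addr_ge0 ?expR_ge0.
  apply: ler_wpDl; first exact: expR_ge0.
  by apply: e1; rewrite subr_ge0 ler_wpM2l ?ltW.
rewrite meanD !meanZ.
apply: (@le_trans _ _ (C1 * expR (2 * l * mu * N%:R) + C2 * expR (- (l * mu / 2) *
    N%:R))).
  by apply: lerD; rewrite ler_wpM2l // expR_ge0.
rewrite -!expRD [leRHS]mulr_natl mulr2n.
have X0 : 0 <= l * mu * N%:R by rewrite !mulr_ge0 // ltW.
have -> : N%:R * (mu / (8 * B)) = l * mu * N%:R / 4 by rewrite /l; field; rewrite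
    gt_eqF.
move: X0; set X := l * mu * N%:R => X0.
apply: lerD; rewrite ler_expR.
  by rewrite (_ : _ + _ = - (2 * X)); [lra | rewrite /X; ring].
by rewrite (_ : _ + _ = - (X / 4)); [lra | rewrite /X; field].
Qed.

(** This counts grid values per coordinate. With r = sqrt n, r / 4 <= exp (r / 4) gives n^2 = r^4 <=
    256 exp r, and the remaining constant factor is absorbed into a since r >= 1. *)
Lemma grid_size_le (R : realType) (D : nat) :
  exists a : nat, forall n : nat, (0 < n)%N ->
    (2 * (D * n ^ 2)).+1%:R <= expR (a%:R * Num.sqrt n%:R) :> R.
Proof.
exists (512 * D + 2)%N => n n0.
have nR1 : (1 : R) <= n%:R by rewrite ler1n.
set r := Num.sqrt n%:R; have r1 : 1 <= r :> R by rewrite -sqrtr1 ler_wsqrtr.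
have r2 : r ^+ 2 = n%:R by rewrite sqr_sqrtr.
have n2 : n%:R ^+ 2 <= 256 * expR r.
  have h : r / 4 <= expR (r / 4) by apply: le_trans (expR_ge1Dx _); rewrite lerDr.
  have -> : expR r = expR (r / 4) ^+ 4.
    by rewrite -expRM_natr; congr expR; field.
  have -> : 256 * expR (r / 4) ^+ 4 = (4 * expR (r / 4)) ^+ 4 by ring.
  rewrite -r2 -exprM; apply: lerXn2r; rewrite ?nnegrE ?mulr_ge0 ?expR_ge0 //; lra.
have er : 1 <= expR r by rewrite -expR0 ler_expR; lra.
apply: (@le_trans _ _ ((512 * D%:R + 1) * expR r)).
  rewrite -natr1 2!natrM natrX.
  have : D%:R * n%:R ^+ 2 <= D%:R * (256 * expR r) :> R by rewrite ler_wpM2l.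
  lra.
have -> : (512 * D + 2)%:R * r = (512 * D%:R + 1) * r + r.
  by rewrite natrD natrM; ring.
rewrite expRD ler_wpM2r ?expR_ge0 //.
apply: le_trans (expR_ge1Dx _); have : 0 <= D%:R :> R by [].
nra.
Qed.

Lemma L1comb_sampling (R : realType) :
  exists c : nat, (0 < c)%N /\
  forall (n N : nat) (T : finType) (w : T -> R) (F : 'I_n -> T -> R),
  (0 < n)%N -> (c * n ^ 3 <= N)%N -> pweight w ->
  (forall i t, `|F i t| <= n%:R) ->
  (forall i, mean w (fun t => `|F i t|) <= 1) ->
  (forall x : 'I_n -> R, Num.sqrt (\sum_i x i ^+ 2) / 16 <= L1comb w F x) ->
  exists o : 'I_N -> T, forall x : 'I_n -> R,
    L1comb w F x / 8 <= L1comb (fun=> N%:R^-1) (fun i k => F i (o k)) x <=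
      8 * L1comb w F x.
Proof.
have [D D640] : exists D : nat, 640 <= D%:R :> R by exists 640%N.
have [a ha] := grid_size_le R D.
(* 128 is 8 from the Chernoff exponent times 16 from the Euclidean lower bound; a pays for the size
   of the grid and the extra 2 makes the union bound strictly less than 1. *)
exists (128 * (a + 2))%N; split; first by lia.
move=> n N T w F n0 nN pw Fn F1 Fl2.
have nR1 : (1 : R) <= n%:R by rewrite ler1n.
have nR0 : (0 : R) < n%:R by exact: lt_le_trans nR1.
have N0 : (0 < N)%N by apply: leq_trans nN; rewrite muln_gt0 expn_gt0 n0 andbT; lia.
have NR0 : (0 : R) < N%:R by rewrite ltr0n.
pose K := (D * n ^ 2)%N.
set r := Num.sqrt (n%:R : R).
have r1 : 1 <= r by rewrite -sqrtr1 ler_wsqrtr.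
have r0 : 0 < r by exact: lt_le_trans r1.
have r2 : r ^+ 2 = n%:R by rewrite sqr_sqrtr // ltW.
pose Z := {ffun 'I_n -> 'I_(2 * K).+1}.
pose z (b : Z) := @grid_point R n K b.
pose X (b : Z) (t : T) := `|\sum_i z b i * F i t|.
pose bad (b : Z) (o : {ffun 'I_N -> T}) :=
  (4 * (N%:R * mean w (X b)) < \sum_k X b (o k)) ||
  (\sum_k X b (o k) < N%:R * mean w (X b) / 4).
have pbad b : mean (prodw 'I_N w) (fun o => (bad b o)%:R) <=
    2 * expR (- ((a + 2)%:R * r * n%:R)).
  pose s := \sum_i `|z b i|; have s0 : 0 <= s by apply: sumr_ge0.
  have XB t : 0 <= X b t <= n%:R * s.
    rewrite normr_ge0 /=; apply: le_trans (ler_norm_sum _ _ _) _.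
    rewrite mulr_sumr; apply: ler_sum => i _.
    by rewrite normrM mulrC ler_wpM2r.
  (* At the zero grid point every sample is 0, and the strict inequalities in [bad] read 0 < 0. *)
  have [sz|sN0] := eqVneq s 0.
    have X0 t : X b t = 0.
      by have := XB t; rewrite sz mulr0 => /le_anti.
    have -> : mean (prodw 'I_N w) (fun o => (bad b o)%:R) = mean (prodw 'I_N w)
        (fun=> 0).
      apply: eq_mean => o; rewrite /bad.
      have -> : mean w (X b) = 0.
        by rewrite -[RHS](mean_cst _ _ _ 0 pw); apply: eq_mean.
      by rewrite (eq_bigr (fun=> 0)) // big1 // !mulr0 mul0r ltxx.
    rewrite mean_cst; last exact: prodw_pweight.
    by rewrite mulr_ge0 // expR_ge0.
  have sp : 0 < s by rewrite lt_def sN0.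
  have B0 : 0 < n%:R * s by rewrite mulr_gt0.
  apply: (le_trans (two_sided_chernoff R T w (X b) (n%:R * s) N pw B0 XB)).
  rewrite ler_pM2l // ler_expR lerN2.
  (* The summands are at most n s, hence at most 16 n sqrt n times their mean, and the Chernoff
     exponent is at least N / (128 n sqrt n). *)
  have mu : s / (16 * r) <= mean w (X b).
    apply: le_trans (Fl2 (z b)); have := l1_le_l2 _ _ (z b); rewrite -/s -/r => h.
    rewrite ler_pdivrMr ?mulr_gt0 //; lra.
  apply: (@le_trans _ _ (N%:R * ((s / (16 * r)) / (8 * (n%:R * s))))); last first.
    by rewrite ler_wpM2l // ler_wpM2r // invr_ge0 mulr_ge0 // ltW.
  have -> : N%:R * (s / (16 * r) / (8 * (n%:R * s))) = N%:R / (128 * (r * n%:R)).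
    by field; rewrite !gt_eqF.
  rewrite ler_pdivlMr ?mulr_gt0 //.
  apply: (@le_trans _ _ (128 * (a + 2) * n ^ 3)%N%:R); last by rewrite ler_nat.
  rewrite 2!natrM natrX -[in leRHS]r2 -[in leLHS]r2.
  rewrite le_eqVlt; apply/orP; left; apply/eqP; ring.
(* Union bound: if every sample were bad somewhere, the mean number of bad grid points would be at
   least 1, yet it is at most 2 exp (- 2 n sqrt n) < 1. *)
have [om good] : exists o : {ffun 'I_N -> T}, forall b, ~~ bad b o.
  apply: contrapT => none.
  have some o : (1 : R) <= \sum_b (bad b o)%:R.
    have [b hb] : exists b, bad b o.
      apply: contrapT => h; apply: none; exists o => b; apply/negP => hb.
      by apply: h; exists b.
    by rewrite (bigD1 b) //= hb lerDl sumr_ge0.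
  have pN := prodw_pweight _ 'I_N _ _ pw.
  have := ler_mean _ _ _ _ _ pN some.
  rewrite mean_cst // mean_sum; apply/negP; rewrite -ltNge.
  apply: (@le_lt_trans _ _ (\sum_(b : Z) 2 * expR (- ((a + 2)%:R * r * n%:R)))).
    exact: ler_sum.
  rewrite sumr_const card_ffun !card_ord. rewrite -[ltLHS]mulr_natl natrX.
  apply: (@le_lt_trans _ _ (expR (a%:R * r) ^+ n * (2 * expR (- ((a + 2)%:R * r *
      n%:R))))).
    rewrite ler_wpM2r ?mulr_ge0 ?expR_ge0 //.
    by apply: lerXn2r; rewrite ?nnegrE ?expR_ge0 //; apply: ha.
  rewrite -expRM_natr mulrCA -expRD.
  have -> : a%:R * r * n%:R + - ((a + 2)%:R * r * n%:R) = - (2 * (r * n%:R)).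
    by rewrite natrD; ring.
  have rn : 1 <= r * n%:R by nra.
  rewrite expRN ltr_pdivrMr ?expR_gt0 // mul1r.
  have := expR_ge1Dx (2 * (r * n%:R)); lra.
have pu : pweight (fun _ : 'I_N => N%:R^-1 : R).
  by split=> [_|]; rewrite ?invr_ge0 // sumr_const card_ord -[LHS]mulr_natr mulVf
      // gt_eqF.
exists om; apply: (@L1comb_net R n K) => //.
  by rewrite /K natrM natrX ler_wpM2r // exprn_ge0.
move=> b; have := good b; rewrite negb_or -!leNgt => /andP[gu gl] /=.
have -> : L1comb (fun=> N%:R^-1) (fun i k => F i (om k)) (grid_point n K b) =
    N%:R^-1 * \sum_k X b (om k).
  by rewrite mulr_sumr.
have -> : L1comb w F (grid_point n K b) = mean w (X b) by [].
rewrite ler_pdivlMl // ler_pdivrMl // mulrA gl /=.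
by rewrite mulrCA.
Qed.

(** * Orlicz functions and the Luxemburg norm *)

Lemma orlicz_scale_le (R : realType) (M : R -> R) :
  Orlicz_function M ->
  forall s t, 0 <= s <= 1 -> 0 <= t -> M (s * t) <= s * M t.
Proof.
move=> [_ Mcvx Mz _] s t /andP[s0 s1] t0.
have tD : t \in `[0, +oo[%classic by rewrite inE /= in_itv /= t0.
have zD : (0 : R) \in `[0, +oo[%classic by rewrite inE /= in_itv /= lexx.
have : M (s * t + (1 - s) * 0) <= s * M t + (1 - s) * M 0 :=
  Mcvx (Itv01 s0 s1) t 0 tD zD.
by rewrite Mz !mulr0 !addr0.
Qed.

(** Concavity of M o sqrt on the segment from 0 to t^2, at weight s^2. *)
Lemma orlicz_scale_ge (R : realType) (M : R -> R) :
  Orlicz_function M -> strictly_2concave M ->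
  forall s t, 0 <= s <= 1 -> 0 <= t -> s ^+ 2 * M t <= M (s * t).
Proof.
move=> [M0 _ Mz _] M2 s t /andP[s0 s1] t0.
have [->|sN0] := eqVneq s 0; first by rewrite expr0n !mul0r Mz.
have [->|sN1] := eqVneq s 1; first by rewrite expr1n !mul1r.
have [->|tN0] := eqVneq t 0; first by rewrite mulr0 Mz mulr0.
have sp : 0 < s by rewrite lt_def sN0.
have sl1 : s < 1 by rewrite lt_def eq_sym sN1.
have tp : 0 < t by rewrite lt_def tN0.
have tD : `[0, +oo[%classic (t ^+ 2) by rewrite /= in_itv /= sqr_ge0.
have zD : `[0, +oo[%classic (0 : R) by rewrite /= in_itv /= lexx.
have s2 : 0 < s ^+ 2 < 1 by rewrite exprn_gt0 // exprn_ilt1.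
have := M2 _ _ _ tD zD (lt0r_neq0 (exprn_gt0 2 tp)) s2.
by rewrite mulr0 addr0 -exprMn sqrtr0 Mz mulr0 addr0 !sqrtr_sqr !ger0_norm
    ?mulr_ge0 // => /ltW.
Qed.

(** Testing the conjugate at t = 2 gives M 2 >= 1, hence M 1 >= 1/4. If M 1 > 1, then M t >= t^2 on
    [0, 1] and M t >= t beyond, so t - M t never exceeds 1/4 and the supremum cannot be 1. *)
Lemma orlicz_at_one (R : realType) (M : R -> R) :
  Orlicz_function M -> strictly_2concave M -> conjugate M 1 = 1%E ->
  4^-1 <= M 1 <= 1.
Proof.
move=> MO M2 M1; have Mc := orlicz_scale_le _ _ MO.
have M2' := orlicz_scale_ge _ _ MO M2.
have ub (t : R) : 0 <= t -> t - M t <= 1.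
  move=> t0; rewrite -lee_fin -[leRHS]M1; apply: ereal_sup_ubound.
  by exists t; rewrite ?mul1r //= in_itv /= t0.
apply/andP; split.
  have h2 := ub 2 (ler0n _ _).
  have h : 0 <= (2^-1 : R) <= 1 by apply/andP; split; lra.
  have := M2' _ 2 h (ler0n _ _); rewrite mulVf ?pnatr_eq0 //; lra.
rewrite leNgt; apply/negP => h.
suff : (conjugate M 1 <= (4^-1)%:E)%E by rewrite M1 lee_fin; lra.
apply: ge_ereal_sup => y [t] /=; rewrite in_itv /= andbT => t0 <-.
rewrite lee_fin mul1r; have [t1|t1] := leP t 1.
  have := M2' t 1; rewrite t0 t1 mulr1 => /(_ isT ler01).
  have := sqr_ge0 (t - 2^-1); have := sqr_ge0 t; nra.
have tp : 0 < t by lra.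
have ti : 0 <= t^-1 <= 1 by rewrite invr_ge0 t0 /= invf_le1 // ltW.
have := Mc _ t ti t0; rewrite mulVf ?gt_eqF // mulrC ler_pdivlMr //; nra.
Qed.

Lemma Luxemburg_norm_le (R : realType) (M : R -> R) (n : nat) (x : 'rV[R]_n)
    (l : R) :
  0 < l -> \sum_(i < n) M (`|x ord0 i| / l) <= 1 -> Luxemburg_norm M x <= l.
Proof.
move=> l0 hl; apply: ge_inf => //.
by exists 0 => k [/ltW].
Qed.

(** An infimum at most 1 only guarantees an admissible level below 2; the factor 2 pays for this, by
    monotonicity of M. *)
Lemma Luxemburg_norm_le1 (R : realType) (M : R -> R) (n : nat) (x : 'rV[R]_n) :
  Orlicz_function M -> Luxemburg_norm M x <= 1 ->
  \sum_(i < n) M (`|x ord0 i| / 2) <= 1.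
Proof.
move=> MO x1; have Mc := orlicz_scale_le _ _ MO.
have M0 t : 0 <= t -> 0 <= M t by case: MO => + _ _ _; apply.
have ne : [set l : R | 0 < l /\ \sum_(i < n) M (`|x ord0 i| / l) <= 1] !=set0.
  pose S := \sum_(i < n) M `|x ord0 i|.
  have S0 : 0 <= S by apply: sumr_ge0 => i _; apply: M0.
  have S1 : 0 < 1 + S by rewrite ltr_pwDl.
  exists (1 + S); split=> //.
  apply: (@le_trans _ _ (\sum_(i < n) (1 + S)^-1 * M `|x ord0 i|)).
    apply: ler_sum => i _; rewrite mulrC; apply: Mc => //.
    by rewrite invr_ge0 ltW //= invf_le1 // lerDl.
  by rewrite -mulr_sumr -/S ler_pdivrMl // mulr1 lerDr.
have [|l [l0 hl] l2] := inf_lt ne (_ : _ < 2); first by apply: le_lt_trans x1 _; lra.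
apply: le_trans hl; apply: ler_sum => i _.
apply: orlicz_mono => //; rewrite divr_ge0 //= ler_wpM2l //.
by rewrite lef_pV2 ?posrE // ltW.
Qed.

Lemma Luxemburg_norm_ge0 (R : realType) (M : R -> R) (n : nat) (x : 'rV[R]_n) :
  0 <= Luxemburg_norm M x.
Proof.
rewrite /Luxemburg_norm; set E := (X in inf X).
(* The infimum of the empty set is 0 by convention. *)
have [->|/set0P ne] := eqVneq E set0; first by rewrite inf0.
by apply: lb_le_inf => // l [/ltW].
Qed.

(** * The embedding *)

(** Each bound controls one of the suprema over unit balls. The conditions at 0 put 0 in both balls,
    so the suprema are nonnegative and their extended-real product is monotone. *)
Lemma C_embeds_of_bounds (R : realType) (X Y : lmodType R) (NX : X -> R)
    (NY : Y -> R) (Psi : {linear X -> Y}) (A B : R) :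
  1 <= A * B -> 0 <= NX 0 <= 1 -> 0 <= NY 0 <= 1 -> injective Psi ->
  (forall x, NX x <= 1 -> NY (Psi x) <= A) ->
  (forall x, NY (Psi x) <= 1 -> NX x <= B) ->
  C_embeds (A * B) NX NY.
Proof.
move=> AB /andP[X0 X1] /andP[Y0 Y1] inj hA hB; split=> //.
pose Phi y := xget 0 [set x | Psi x = y].
have PhiK : cancel Psi Phi.
  move=> x; apply: inj.
  exact: (@xgetPex _ 0 [set z | Psi z = Psi x] (ex_intro _ x erefl)).
have Phi0 : Phi 0 = 0 by rewrite -[X in Phi X](raddf0 Psi) PhiK.
exists Psi, Phi; split=> //; rewrite EFinM; apply: lee_pmul.
- apply: (@le_trans _ _ (NY (Psi 0))%:E); first by rewrite raddf0 lee_fin.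
  by apply: ereal_sup_ubound; exists 0.
- apply: (@le_trans _ _ (NX (Phi 0))%:E); first by rewrite Phi0 lee_fin.
  apply: ereal_sup_ubound; exists 0 => //; split=> //.
  by exists 0 => //; rewrite raddf0.
- apply: ge_ereal_sup => y [x [_ /= x1] <-]; rewrite lee_fin; exact: hA.
- apply: ge_ereal_sup => y [_ [[x _ <-] /= x1] <-].
  by rewrite lee_fin PhiK; apply: hB.
Qed.

Theorem theorem1p3 (R : realType) :
  exists c C : R, 0 < c /\ 0 < C /\
    forall (n : nat) (M : R -> R),
      Orlicz_function M ->
      strictly_convex_on `[0, +oo[%classic M ->
      twice_differentiable_on `[0, +oo[%classic M ->
      strictly_2concave M ->
      conjugate M 1 = 1%E ->
      C_embeds C (@Luxemburg_norm R M n)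
        (@l1_norm R `|Num.ceil (c * n%:R ^+ 3)|%N).
Proof.
have [c [c0 sampling]] := L1comb_sampling R.
(* 704 = 8 * 88 combines the sampling factor with the upper estimate; 592 = 2 * 296 comes from the
   lower one. *)
exists c%:R, (704 * 592); split; first by rewrite ltr0n.
split; first by lra.
move=> n M MO _ _ M2 M1.
have Mc := orlicz_scale_le _ _ MO.
have M2' := orlicz_scale_ge _ _ MO M2.
have M11 := orlicz_at_one _ _ MO M2 M1.
have M0 t : 0 <= t -> 0 <= M t by case: MO => + _ _ _; apply.
have -> : `|Num.ceil (c%:R * n%:R ^+ 3 : R)|%N = (c * n ^ 3)%N.
  by rewrite -natrX -natrM -[X in Num.ceil X]/((c * n ^ 3)%N%:~R) intrKceil.
set N := (c * n ^ 3)%N.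
have sum0 : \sum_(i < n) M 0 = 0 by rewrite big1 // => i _; case: MO.
suff [Psi [upper lower inj]] : exists Psi : {linear 'rV[R]_n -> 'rV[R]_N},
    [/\ forall x, Luxemburg_norm M x <= 1 -> l1_norm (Psi x) <= 704,
        forall x, l1_norm (Psi x) <= 1 -> Luxemburg_norm M x <= 592 &
        injective Psi].
  apply: (@C_embeds_of_bounds _ _ _ _ _ Psi) => //; first lra.
    rewrite Luxemburg_norm_ge0 Luxemburg_norm_le //.
    by under eq_bigr do rewrite mxE normr0 mul0r; rewrite sum0.
  by rewrite /l1_norm big1 ?lexx ?ler01 // => i _; rewrite mxE normr0.
(* In dimension 0 the zero map works: all row vectors coincide and the sums over coordinates are
   empty. *)
have [n0|n0] := posnP n.
  exists (mulmxr (0 : 'M[R]_(n, N))); split=> [x _|x _|x y _].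
  - rewrite /= mulmx0 /l1_norm big1 => [|i _]; last by rewrite mxE normr0.
    exact: ler0n.
  - apply: Luxemburg_norm_le; first by rewrite ltr0n.
    rewrite big1 // => i _.
    by have := ltn_ord i; rewrite {2}n0.
  - by apply/rowP => i; have := ltn_ord i; rewrite {2}n0.
have [T [w [F [pw [Fn F1] Fl2 Fup Flow]]]] :=
  orlicz_random_vector _ _ _ n0 M0 Mc M2' M11.
have [om good] := sampling _ N _ _ _ n0 (leqnn _) pw Fn F1 Fl2.
pose A := \matrix_(i < n, k < N) (N%:R^-1 * F i (om k)).
have l1E (x : 'rV[R]_n) : l1_norm (mulmxr A x) =
    L1comb (fun=> N%:R^-1) (fun i k => F i (om k)) (x ord0).
  apply: eq_bigr => k _; rewrite /= mxE.
  rewrite -[X in X * `|_|](@ger0_norm _ N%:R^-1) // -normrM mulr_sumr.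
  congr `|_|; apply: eq_bigr => i _; rewrite mxE; ring.
exists (mulmxr A); split.
- move=> x x1; rewrite l1E; have /andP[_] := good (x ord0).
  have := Fup (x ord0) (Luxemburg_norm_le1 _ _ _ _ MO x1).
  lra.
- move=> x; rewrite l1E => x1; have /andP[gl _] := good (x ord0).
  have L8 : L1comb w F (x ord0) <= 8 by lra.
  (* Any number above 8 * 36 = 288 makes the scaled norm strictly less than 1/36. *)
  have i296 : (0 : R) <= 296^-1 by rewrite invr_ge0 ler0n.
  apply: Luxemburg_norm_le; first by rewrite ltr0n.
  have := Flow (fun i => 296^-1 * x ord0 i).
  rewrite L1combZ (ger0_norm i296) => h.
  have : 296^-1 * L1comb w F (x ord0) < 36^-1 by lra.
  move=> /h; apply: le_trans; rewrite le_eqVlt; apply/orP; left; apply/eqP.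
  apply: eq_bigr => i _; congr (M _); rewrite normrM (ger0_norm i296).
  by field.
(* On the kernel the sampled norm vanishes, hence so do the averaged norm and, by its Euclidean
   lower bound, x itself. *)
- apply: raddf_inj => x xA; apply/rowP => i; rewrite mxE.
  have /andP[gl _] := good (x ord0).
  have l0 : l1_norm (mulmxr A x) = 0.
    by rewrite xA /l1_norm big1 // => k _; rewrite mxE normr0.
  have q0 : Num.sqrt (\sum_k x ord0 k ^+ 2) <= 0.
    by have := Fl2 (x ord0); move: gl; rewrite -l1E l0 /L1comb; lra.
  have : `|x ord0 i| <= Num.sqrt (\sum_k x ord0 k ^+ 2).
    rewrite -sqrtr_sqr ler_wsqrtr // (bigD1 i) //= lerDl sumr_ge0 // => j _.
    by rewrite sqr_ge0.
  by move=> /le_trans/(_ q0); rewrite normr_le0 => /eqP.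
Qed.
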